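(* Let $f:\mathbb{R}^n\to\mathbb{R}^n$ be a Lipschitz mapping such that $\partial f(x)$ has maximal rank for all $x\in\mathbb{R}^n$, and suppose that there is some $\varepsilon>0$ satisfying $$\operatorname{Spec}(\partial f(x))\cap\{z\in\mathbb{C}:|z|\le\varepsilon\}=\emptyset\quad\text{for all }x\in\mathbb{R}^n.$$ Then $f$ is a global homeomorphism (from $\mathbb{R}^n$ onto $\mathbb{R}^n$).
   Context: For a Lipschitz mapping $f:\mathbb{R}^n\to\mathbb{R}^n$, the Clarke generalized differential $\partial f(x)$ is the convex hull of all limits $\lim_i df(x_i)$ with $x_i\to x$ and $f$ differentiable at each $x_i$, where $df(x_i)$ is identified with the Jacobian matrix. $\partial f(x)$ has maximal rank if every matrix in $\partial f(x)$ is invertible. $\operatorname{Spec}(\partial f(x))$ denotes the set of all complex eigenvalues of all matrices $A\in\partial f(x)$. *)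

(* Defs.v *)
From mathcomp Require Import all_boot all_order all_algebra.
From mathcomp Require Import complex.
From mathcomp Require Import all_classical all_reals all_analysis.

Set Implicit Arguments.
Unset Strict Implicit.
Unset Printing Implicit Defensive.

Import Order.TTheory GRing.Theory Num.Theory.
Import numFieldNormedType.Exports.

Local Open Scope classical_set_scope.
Local Open Scope ring_scope.
Local Open Scope complex_scope.

Definition convex_hull (R : realType) (V : lmodType R) (S : set V) : set V :=
  [set v | exists k (c : 'I_k -> R) (s : 'I_k -> V),
     [/\ forall i, 0 <= c i, \sum_i c i = 1, forall i, S (s i)
       & v = \sum_i c i *: s i]].

(* Points of R^n are row vectors, so ['J f p] is the matrix of the linear map
   ['d f p] acting by [v |-> v *m 'J f p], i.e. the transpose of the Jacobian
   matrix acting on columns. Transposition is a linear homeomorphism that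
   preserves invertibility and eigenvalues. *)
Definition limiting_jacobians (R : realType) (n : nat)
    (f : 'rV[R]_n -> 'rV[R]_n) (x : 'rV[R]_n) : set 'M[R]_n :=
  [set A | exists u : nat -> 'rV[R]_n,
     [/\ u i @[i --> \oo] --> x, forall i, differentiable f (u i)
       & 'J f (u i) @[i --> \oo] --> A]].

Definition clarke_diff (R : realType) (n : nat)
    (f : 'rV[R]_n -> 'rV[R]_n) (x : 'rV[R]_n) : set 'M[R]_n :=
  convex_hull (limiting_jacobians f x).

Definition maximal_rank (R : realType) (n : nat) (S : set 'M[R]_n) : Prop :=
  forall A, S A -> A \in unitmx.

Definition Spec (R : realType) (n : nat) (S : set 'M[R]_n) : set R[i] :=
  [set z | exists2 A, S A & eigenvalue (map_mx (real_complex R) A) z].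

Definition homeomorphism (T U : topologicalType) (f : T -> U) : Prop :=
  continuous f /\ exists g : U -> T, [/\ cancel f g, cancel g f & continuous g].

(* Main.v *)
(** A matrix [A] of the Clarke differential has entries bounded by the Lipschitz
    constant and [|det A| >= eps ^ n], so by Cramer's rule [|v A|] and [|v A^T|]
    are bounded below by [kap |v|], uniformly in [A] and in the base point.
    Separating the convex sets [{v A}] and [{u A^T}] from [0] and using a mean
    value inequality that only involves the derivatives of [f] at points of
    differentiability, one gets that [f] is locally injective with a uniform
    constant, and that [|f - y|] decreases at a uniform rate in some direction
    wherever it does not vanish. Minimising [|f z - y| + sigma |z - x|] then
    yields a solution of [f z = y] at distance [O(|f x - y|)] from [x], and
    lifting a linear contraction of the loop [f ([a, b])] gives injectivity.

    The mean value inequality is a quantitative Rademacher theorem, proved here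
    without measure theory. For a periodic Lipschitz [g] the dyadic difference
    quotients [D_N g] are Cauchy in mean square over fine grids; the weak type
    maximal inequality on the dyadic tree produces points around which [D_N g]
    has small oscillation in mean at every scale; by a Poincare type argument
    [g] is almost affine near such a point at every scale, hence
    differentiable there. Limits along an ultrafilter [U] on the grid level
    replace integrals. *)
Require Import Defs.
From mathcomp Require Import all_boot all_order all_algebra.
From mathcomp Require Import perm complex.
From mathcomp Require Import all_classical all_reals all_analysis.
From mathcomp Require Import zify ring lra.

Set Implicit Arguments.
Unset Strict Implicit.
Unset Printing Implicit Defensive.

Import Order.TTheory GRing.Theory Num.Theory.
Import numFieldNormedType.Exports.

Local Open Scope classical_set_scope.
Local Open Scope ring_scope.
Local Open Scope complex_scope.

(** * Dyadic grids *)

(** Local invertibility alone never yields a global bijection; uniformity does. The constants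
    [inj_const] and [reg_const] depend on [n], [L] and [kap] only. The radius of local injectivity
    is uniform merely on bounded sets, which suffices because lifted loops stay bounded. The bound
    on [v A] serves injectivity, the one on [A^T] serves descent: for a residual [u] it provides a
    direction [v] along which every [v A] has a definite component on [u]. A segment may miss every
    point of differentiability, so it is thickened to a tube, and the tube must contain a point of
    differentiability whose directional derivative is at most nearly the mean slope; bare existence
    of such points would not be enough. The ultrafilter also decides alternatives: the mean
    oscillation in a cube is eventually below or eventually above a threshold, so a condition on all
    finer grids can be tested in one finite grid, where the maximal inequality is counting. Each
    such test meets finitely many conditions only, and the final point is a cluster point of the
    points found. This is why the conditions include neighbouring cubes. *)

Definition dyadic {R : realType} (k : nat) : R := 2%:R^-1 ^+ k.

(* [a : grid n m] indexes the cube of side [2^-m] of the unit cube whose lower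
   corner is [gpoint a]. *)
Notation grid n m := {ffun 'I_n -> 'I_(2 ^ m)}.

Definition gpoint {R : realType} n m (a : grid n m) : 'rV[R]_n :=
  \row_i ((a i)%:R * dyadic m).

Notation evec i := (delta_mx 0 i : 'rV__).

Definition zperiodic {R : realType} n (T : Type) (G : 'rV[R]_n -> T) :=
  forall i x, G (x + evec i) = G x.

Section Dyadic.
Context {R : realType}.
Implicit Types k l m : nat.

Lemma dyadic_gt0 k : 0 < dyadic k :> R.
Proof. by rewrite exprn_gt0// invr_gt0 ltr0n. Qed.

Lemma dyadic_ge0 k : 0 <= dyadic k :> R.
Proof. exact/ltW/dyadic_gt0. Qed.

Lemma dyadicE k l : (k <= l)%N -> dyadic k = (2 ^ (l - k))%:R * dyadic l :> R.
Proof.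
move=> kl; rewrite -[in dyadic l](subnK kl) /dyadic exprD mulrA natrX -exprMn.
by rewrite mulfV ?pnatr_eq0// expr1n mul1r.
Qed.

Lemma dyadic_pow k : (2 ^ k)%:R * dyadic k = 1 :> R.
Proof. by rewrite natrX -exprMn mulfV ?pnatr_eq0// expr1n. Qed.

Lemma dyadic_le k l : (k <= l)%N -> dyadic l <= dyadic k :> R.
Proof.
move=> kl; rewrite (dyadicE kl) ler_peMl ?dyadic_ge0// ler1n.
by rewrite expn_gt0.
Qed.

Lemma dyadic_le1 k : dyadic k <= 1 :> R.
Proof. by have := dyadic_le (leq0n k); rewrite {2}/dyadic expr0. Qed.

Lemma dyadicS k : dyadic k = 2 * dyadic k.+1 :> R.
Proof. by rewrite (dyadicE (leqnSn k)) subSnn. Qed.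

Lemma near_dyadic (e : R) : 0 < e -> exists k0, forall k, (k0 <= k)%N -> dyadic k <= e.
Proof.
move=> e0; have : dyadic k @[k --> \oo] --> (0 : R).
  by apply: cvg_expr; rewrite ger0_norm ?invr_ge0// invf_lt1// ltr1n.
move/cvgrPdist_le => /(_ _ e0)[k0 _ H]; exists k0 => k /H /=.
by rewrite sub0r normrN ger0_norm// dyadic_ge0.
Qed.

End Dyadic.

Section MatrixNorm.
Context {R : realType} {m n : nat}.
Implicit Types (x : 'M[R]_(m, n)).

Lemma mx_norm_leP x (c : R) : 0 <= c -> (forall i j, `|x i j| <= c) -> `|x| <= c.
Proof.
move=> c0 H; rewrite [leLHS]/Num.Def.normr/= mx_normrE.
by apply/bigmax_leP; split => // -[i j] _ /=.
Qed.

Lemma mx_entry_le x i j : `|x i j| <= `|x|.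
Proof.
rewrite [leRHS]/Num.Def.normr/= mx_normrE; apply/bigmax_geP; right.
by exists (i, j).
Qed.

End MatrixNorm.

Section GridSum.
Context {R : realType} {n : nat}.
Implicit Types (m k : nat) (G H : 'rV[R]_n -> R) (i : 'I_n) (x : 'rV[R]_n).

Definition gsum m G : R := \sum_(a : grid n m) G (gpoint a).

Lemma card_grid m : #|{: grid n m}| = ((2 ^ m) ^ n)%N.
Proof. by rewrite card_ffun !card_ord. Qed.

Lemma ler_gsum m G H : (forall x, G x <= H x) -> gsum m G <= gsum m H.
Proof. by move=> GH; apply: ler_sum. Qed.

Lemma gsum_cst m (c : R) : gsum m (fun=> c) = c * ((2 ^ m) ^ n)%:R.
Proof. by rewrite /gsum sumr_const card_grid mulr_natr. Qed.

Lemma gsumD m G H : gsum m (fun x => G x + H x) = gsum m G + gsum m H.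
Proof. exact: big_split. Qed.

Lemma gsumZ m c G : gsum m (fun x => c * G x) = c * gsum m G.
Proof. by rewrite /gsum mulr_sumr. Qed.

(** The successor is cyclic, so that it permutes the grid: together with periodicity, sums over the
    grid become invariant under dyadic translations. *)
Definition grid_succ m i (a : grid n m) : grid n m :=
  [ffun j => if j == i then ordS (a j) else a j].

Lemma grid_succ_inj m i : injective (@grid_succ m i).
Proof.
move=> a b /ffunP ab; apply/ffunP => j; have := ab j; rewrite !ffunE.
by case: eqP => // _ /ordS_inj.
Qed.

Lemma gpoint_succ m i (a : grid n m) T (G : 'rV[R]_n -> T) : zperiodic G ->
  G (gpoint (grid_succ i a)) = G (gpoint a + dyadic m *: evec i).
Proof.
move=> pG; have [lt|ge] := ltnP (a i).+1 (2 ^ m).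
  congr G; apply/rowP => j; rewrite !mxE eqxx/= !ffunE.
  case: eqP => [->|_] /=; last by rewrite mulr0 addr0.
  by rewrite modn_small// mulr1 -natr1 mulrDl mul1r.
rewrite -(pG i (gpoint (grid_succ i a))).
congr G; apply/rowP => j; rewrite !mxE eqxx/= !ffunE.
case: eqP => [->|_] /=; last by rewrite mulr0 !addr0.
have ai : (a i).+1 = (2 ^ m)%N by apply/eqP; rewrite eqn_leq ge ltn_ord.
have -> : (a i)%:R * dyadic m + dyadic m * 1 = (a i).+1%:R * dyadic m :> R.
  by rewrite -natr1 mulr1 mulrDl mul1r.
rewrite ai modnn mul0r add0r.
by rewrite dyadic_pow.
Qed.

Lemma zperiodicT T (G : 'rV[R]_n -> T) (y : 'rV[R]_n) :
  zperiodic G -> zperiodic (fun x => G (x + y)).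
Proof. by move=> pG i x; rewrite addrAC pG. Qed.

Lemma gsum_shift1 m i G : zperiodic G ->
  gsum m (fun x => G (x + dyadic m *: evec i)) = gsum m G.
Proof.
move=> pG; rewrite /gsum [RHS](reindex_inj (@grid_succ_inj m i)) /=.
by apply: eq_bigr => a _; rewrite gpoint_succ.
Qed.

Lemma gsum_shift m i s k G : zperiodic G -> (k <= m)%N ->
  gsum m (fun x => G (x + (s%:R * dyadic k) *: evec i)) = gsum m G.
Proof.
move=> pG km; rewrite (dyadicE km) mulrA -natrM; move: (_ * _)%N => {}s.
elim: s G pG => [|s IHs] G pG.
  by apply: eq_bigr => a _; rewrite mul0r scale0r addr0.
rewrite -[RHS](gsum_shift1 _ i) // -[RHS]IHs; last exact: zperiodicT.
apply: eq_bigr => a _; congr G; rewrite -natr1 mulrDl mul1r scalerDl.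
by rewrite addrA.
Qed.

End GridSum.

(** * Mean square convergence of difference quotients *)

(** A bounded sequence has a cluster point by compactness, and along an ultrafilter a cluster point
    is a limit. Limits of many sequences can thus be taken along the same [U], without extracting
    subsequences. *)
Lemma ultra_bounded_limit {R : realType} (U : set_system nat) (s : nat -> R)
    (a b : R) : UltraFilter U -> (\forall m \near U, a <= s m <= b) ->
  exists l : R, forall e, 0 < e -> \forall m \near U, `|s m - l| <= e.
Proof.
move=> UU sab.
have [l [_ cl]] := segment_compact (fmap_proper_filter s _) sab.
exists l => e e0; have [//|nU] := in_ultra_setVsetC [set m | `|s m - l| <= e] UU.
have [x [/= nle xl]] := cl [set y | ~ `|y - l| <= e] (ball l e) nU (nbhsx_ballx l e e0).
by case: nle; move: xl; rewrite /ball/= distrC => /ltW.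
Qed.

Section QuotientL2.
Context {R : realType} {n : nat}.
Implicit Types (m k l s : nat) (G H : 'rV[R]_n -> R) (i : 'I_n) (x : 'rV[R]_n).

Lemma norm_evec (c : R) i : `|c *: (evec i : 'rV[R]_n)| = `|c|.
Proof.
apply/eqP; rewrite eq_le; apply/andP; split.
  apply: mx_norm_leP => // u v; rewrite !mxE ord1 eqxx/=.
  by case: eqP => _; rewrite ?mulr0 ?normr0// mulr1.
by have := mx_entry_le (c *: (evec i : 'rV[R]_n)) 0 i; rewrite !mxE !eqxx mulr1.
Qed.

Definition dquot k i G x : R := (G (x + dyadic k *: evec i) - G x) / dyadic k.

Definition line_avg s (t : R) i G x : R :=
  s%:R^-1 * \sum_(l < s) G (x + (l%:R * t) *: evec i).

(** Jensen's inequality for the square, by averaging the tangent inequality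
    [2 * A * y - A ^+ 2 <= y ^+ 2] at the mean [A]. *)
Lemma line_avg_sqr s t i G x : (0 < s)%N ->
  line_avg s t i G x ^+ 2 <= line_avg s t i (fun y => G y ^+ 2) x.
Proof.
move=> s0; pose y (l : 'I_s) := G (x + (l%:R * t) *: evec i).
pose A := s%:R^-1 * \sum_l y l.
change (A ^+ 2 <= s%:R^-1 * \sum_l y l ^+ 2).
have sN0 : s%:R != 0 :> R by rewrite pnatr_eq0 -lt0n.
rewrite ler_pdivlMl ?ltr0n//.
have -> : s%:R * A ^+ 2 = \sum_(l < s) (2 * A * y l - A ^+ 2).
  rewrite big_split/= -mulr_sumr sumr_const card_ord.
  have -> : \sum_l y l = s%:R * A by rewrite /A mulrA mulfV// mul1r.
  by rewrite -mulr_natl; ring.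
by apply: ler_sum => l _; rewrite -subr_ge0 (_ : _ - _ = (y l - A) ^+ 2) ?sqr_ge0//; ring.
Qed.

Lemma gsum_line_avg m s k i G : (0 < s)%N -> (k <= m)%N -> zperiodic G ->
  gsum m (line_avg s (dyadic k) i G) = gsum m G.
Proof.
move=> s0 km pG; rewrite /line_avg gsumZ /gsum exchange_big/=.
rewrite (eq_bigr (fun=> gsum m G)); last by move=> l _; apply: gsum_shift.
rewrite sumr_const card_ord -[gsum m G *+ _]mulr_natl mulrA mulVf ?mul1r//.
by rewrite pnatr_eq0 -lt0n.
Qed.

Lemma gsum_line_avg_sqr m s k i G : (0 < s)%N -> (k <= m)%N -> zperiodic G ->
  gsum m (fun x => line_avg s (dyadic k) i G x ^+ 2) <= gsum m (fun x => G x ^+ 2).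
Proof.
move=> s0 km pG; rewrite -[leRHS](@gsum_line_avg m s k i)//; last first.
  by move=> j x; rewrite pG.
by apply: ler_gsum => x; exact: line_avg_sqr.
Qed.

Lemma line_avgC s t s' t' i G x :
  line_avg s t i (line_avg s' t' i G) x = line_avg s' t' i (line_avg s t i G) x.
Proof.
rewrite /line_avg -!mulr_sumr mulrCA exchange_big/=; congr (_ * (_ * _)).
by do 2 apply: eq_bigr => ? _; rewrite addrAC.
Qed.

Lemma line_avgD s t i G H x :
  line_avg s t i (fun x => G x + H x) x = line_avg s t i G x + line_avg s t i H x.
Proof. by rewrite /line_avg -mulrDr big_split. Qed.

(** By telescoping, a coarse quotient is an average of finer ones along the axis. The quotients thus
    behave like a martingale, with mean squares that do not decrease with the level. *)
Lemma dquot_line_avg k l i G x : (k <= l)%N ->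
  dquot k i G x = line_avg (2 ^ (l - k)) (dyadic l) i (dquot l i G) x.
Proof.
move=> kl; rewrite /line_avg /dquot -mulr_suml.
pose g s := G (x + (s%:R * dyadic l) *: evec i).
rewrite (eq_bigr (fun s : 'I__ => g s.+1 - g s)); last first.
  by move=> s _; rewrite /g -[s.+1%:R]natr1 mulrDl mul1r scalerDl addrA.
rewrite -(big_mkord predT (fun s => g s.+1 - g s)) telescope_sumr//.
by rewrite /g -dyadicE// mul0r scale0r addr0 mulrCA -invfM -dyadicE.
Qed.

Lemma periodic_dquot k i G : zperiodic G -> zperiodic (dquot k i G).
Proof. by move=> pG j x; rewrite /dquot pG addrAC pG. Qed.

Lemma periodic_line_avg s t i G : zperiodic G -> zperiodic (line_avg s t i G).
Proof.
move=> pG j x; rewrite /line_avg; congr (_ * _); apply: eq_bigr => l _.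
by rewrite addrAC pG.
Qed.

Variable L : R.
Variable G : 'rV[R]_n -> R.
Hypothesis lipG : forall x y, `|G x - G y| <= L * `|x - y|.

Lemma dquot_bound k i x : `|dquot k i G x| <= L.
Proof.
rewrite /dquot normrM normfV (gtr0_norm (dyadic_gt0 k)) ler_pdivrMr ?dyadic_gt0//.
by apply: (le_trans (lipG _ _)); rewrite addrAC subrr add0r norm_evec gtr0_norm ?dyadic_gt0.
Qed.

Lemma dquot_lip k i x y : `|dquot k i G x - dquot k i G y| <= 2 * L / dyadic k * `|x - y|.
Proof.
rewrite /dquot -mulrBl normrM normfV (gtr0_norm (dyadic_gt0 k)).
rewrite [leRHS]mulrAC ler_pM2r ?invr_gt0 ?dyadic_gt0//.
set x' := x + _; set y' := y + _.
rewrite (_ : G x' - G x - (G y' - G y) = (G x' - G y') + (G y - G x)); last by ring.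
apply: (le_trans (ler_normD _ _)).
rewrite [X in _ <= X](_ : _ = L * `|x - y| + L * `|y - x|); last by rewrite (distrC y); ring.
by apply: lerD => //; apply: (le_trans (lipG _ _)); rewrite /x' /y' opprD addrACA subrr addr0.
Qed.

Hypothesis perG : zperiodic G.

Lemma dquot_mono m k l i : (k <= l)%N -> (l <= m)%N ->
  gsum m (fun x => dquot k i G x ^+ 2) <= gsum m (fun x => dquot l i G x ^+ 2).
Proof.
move=> kl lm; rewrite (_ : (fun x => dquot k i G x ^+ 2) =
    (fun x => line_avg (2 ^ (l - k)) (dyadic l) i (dquot l i G) x ^+ 2)); last first.
  by apply/funext => x; rewrite -dquot_line_avg.
by apply: gsum_line_avg_sqr => //; [rewrite expn_gt0|apply: periodic_dquot].
Qed.

Lemma lip_ge0 (i : 'I_n) : 0 <= L.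
Proof. exact: le_trans (dquot_bound 0 i 0). Qed.

(* Averaging [D_N + D_K] over the shifts of lengths [2^-K] and [2^-N] along the
   [i]-th axis yields almost [2 D_k]; the parallelogram law does the rest. *)
Lemma dquot_cauchy_finite m k K N i : (k <= K)%N -> (K <= N)%N -> (N <= m)%N ->
  gsum m (fun x => (dquot N i G x - dquot K i G x) ^+ 2) <=
  4 * (gsum m (fun x => dquot N i G x ^+ 2) - gsum m (fun x => dquot k i G x ^+ 2))
  + 8 * L ^+ 2 * (dyadic K / dyadic k) * ((2 ^ m) ^ n)%:R.
Proof.
move=> kK KN Nm; set D := fun j => dquot j i G.
have L0 := lip_ge0 i.
pose P := line_avg (2 ^ (K - k)) (dyadic K) i.
pose Q := line_avg (2 ^ (N - K)) (dyadic N) i.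
pose X x := D N x + D K x.
have pX : zperiodic X by move=> j x; rewrite /X /D !periodic_dquot.
have sQ : (0 < 2 ^ (N - K))%N by rewrite expn_gt0.
(* [Q] turns [D N] into [D K], and [P] turns [D K] into [D k]. As [P] and [Q] commute, each summand
   of [X] leaves one copy of [D k], the second one still averaged by [Q]. *)
have PQX x : P (Q X) x = D k x + Q (D k) x.
  rewrite /P /Q (_ : line_avg (2 ^ (N - K)) (dyadic N) i X =
    (fun y => line_avg (2 ^ (N - K)) (dyadic N) i (D N) y +
              line_avg (2 ^ (N - K)) (dyadic N) i (D K) y)); last first.
    by apply/funext => y; rewrite -line_avgD.
  rewrite line_avgD; congr (_ + _).
    rewrite /D (@dquot_line_avg k K)//; congr (line_avg _ _ _ _ _).
    by apply/funext => y; rewrite -dquot_line_avg.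
  rewrite line_avgC; congr (line_avg _ _ _ _ _).
  by apply/funext => y; rewrite -dquot_line_avg.
(* [Q] only shifts by less than [dyadic K], while [D k] is Lipschitz with constant
   [2 * L / dyadic k]. *)
have Qk x : `|Q (D k) x - D k x| <= 2 * L * (dyadic K / dyadic k).
  have -> : Q (D k) x - D k x = (2 ^ (N - K))%:R^-1 *
      \sum_(l < 2 ^ (N - K)) (D k (x + (l%:R * dyadic N) *: evec i) - D k x).
    rewrite /Q /line_avg sumrB mulrBr sumr_const card_ord -[D k x *+ _]mulr_natl.
    by rewrite mulrA mulVf ?mul1r// pnatr_eq0 -lt0n.
  rewrite normrM normfV (ger0_norm (ler0n _ _)) ler_pdivrMl ?ltr0n//.
  apply: (le_trans (ler_norm_sum _ _ _)).
  have sumc (c : R) : (2 ^ (N - K))%:R * c = \sum_(l < 2 ^ (N - K)) c.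
    by rewrite sumr_const card_ord mulr_natl.
  rewrite sumc.
  apply: ler_sum => l _; apply: (le_trans (dquot_lip _ _ _ _)).
  rewrite addrAC subrr add0r norm_evec ger0_norm ?mulr_ge0 ?dyadic_ge0//.
  rewrite -!mulrA ler_wpM2l// ler_wpM2l// [leRHS]mulrC ler_wpM2l ?invr_ge0 ?dyadic_ge0//.
  by rewrite (dyadicE KN) ler_wpM2r ?dyadic_ge0// ler_nat ltnW.
have low : 4 * gsum m (fun x => D k x ^+ 2) - 8 * L ^+ 2 * (dyadic K / dyadic k) * ((2 ^
  m) ^ n)%:R
    <= gsum m (fun x => X x ^+ 2).
  apply: le_trans (gsum_line_avg_sqr i sQ Nm pX).
  apply: le_trans (gsum_line_avg_sqr i (_ : (0 < 2 ^ (K - k))%N) (leq_trans KN Nm)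
    (periodic_line_avg _ _ _ pX)); last first.
    by rewrite expn_gt0.
  rewrite -gsumZ -mulNr -gsum_cst -gsumD; apply: ler_gsum => x.
  rewrite -/(Q X) -/(P (Q X)) PQX.
  have := dquot_bound k i x; have := Qk x; rewrite -/(D k x).
  set r := dyadic K / dyadic k; move: (Q (D k) x) (D k x) => u v ur vL.
  have r0 : 0 <= r by rewrite divr_ge0 ?dyadic_ge0.
  have : `|4 * v * (u - v)| <= 4 * L * (2 * L * r).
    rewrite !normrM (ger0_norm (_ : 0 <= 4))//.
    by apply: ler_pM => //; rewrite ler_wpM2l.
  rewrite ler_norml => /andP[+ _]; have := sqr_ge0 (u - v); nra.
have -> : gsum m (fun x => (D N x - D K x) ^+ 2) =
    2 * gsum m (fun x => D N x ^+ 2) + 2 * gsum m (fun x => D K x ^+ 2)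
    - gsum m (fun x => X x ^+ 2).
  rewrite -!gsumZ -[- _]mulN1r -gsumZ -!gsumD; apply: eq_bigr => a _ /=.
  by rewrite /X; ring.
have := dquot_mono i KN Nm; rewrite -/(D N) -/(D K); lra.
Qed.

(** The normalised mean squares have limits [s k] along [U], bounded by [L ^+ 2]. Past a level [k]
    where [s k] is close to the supremum they can hardly grow, and the finite estimate applies. *)
Lemma dquot_cauchy (U : set_system nat) i : UltraFilter U -> \oo `<=` U ->
  forall eta, 0 < eta -> exists K0, forall K N, (K0 <= K)%N -> (K <= N)%N ->
  \forall m \near U, gsum m (fun x => (dquot N i G x - dquot K i G x) ^+ 2)
    <= eta * ((2 ^ m) ^ n)%:R.
Proof.
move=> UU ooU eta eta0; have L0 := lip_ge0 i.
pose c m : R := ((2 ^ m) ^ n)%:R.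
have c0 m : 0 < c m by rewrite ltr0n expn_gt0 expn_gt0.
pose sg k m := gsum m (fun x => dquot k i G x ^+ 2) / c m.
have sgB k m : 0 <= sg k m <= L ^+ 2.
  apply/andP; split.
    by apply: divr_ge0; [apply: sumr_ge0 => a _; exact: sqr_ge0|exact: ltW].
  rewrite ler_pdivrMr// -gsum_cst; apply: ler_gsum => x.
  by rewrite -[leLHS]real_normK ?num_real// lerXn2r ?nnegrE// dquot_bound.
have geU k : \forall m \near U, (k <= m)%N by apply: ooU; exists k.
have /choice[s sP] k : exists l : R, forall e, 0 < e -> \forall m \near U, `|sg k m - l| <= e.
  by apply: (@ultra_bounded_limit _ _ _ 0 (L ^+ 2)) => //; apply: nearW.
have sB k : s k <= L ^+ 2.
  apply/ler_addgt0Pr => e e0; have [m] := filter_ex (sP k _ e0).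
  by rewrite ler_norml; have /andP[] := sgB k m; lra.
have hs : has_sup (range s).
  by split; [exists (s 0%N), 0%N|exists (L ^+ 2) => _ [k _ <-]].
(* The first term costs at most [4 * 3 * e], with one [e] for the supremum and one for each of two
   limits along [U]; the second term costs [e]. *)
pose e := eta / 20; have e0 : 0 < e by rewrite divr_gt0.
have [_ [k _ <-] ks] := sup_adherent e0 hs.
have sle j : s j <= sup (range s) by apply: ub_le_sup; [case: hs|exists j].
have d0 : 0 < e * dyadic k / (8 * L ^+ 2 + 1).
  by rewrite divr_gt0 ?mulr_gt0 ?dyadic_gt0//; have := sqr_ge0 L; lra.
have [k1 Hk1] := near_dyadic d0.
exists (maxn k k1) => K N; rewrite geq_max => /andP[kK /Hk1 hK] KN.
have := sP N _ e0; have := sP k _ e0; apply: filterS3 (geU N) => m Nm.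
rewrite !ler_norml => /andP[k1' _] /andP[_ N1'].
apply: le_trans (dquot_cauchy_finite i kK KN Nm) _; rewrite -/(c m).
have -> : gsum m (fun x => dquot N i G x ^+ 2) = sg N m * c m by rewrite divfK ?gt_eqF.
have -> : gsum m (fun x => dquot k i G x ^+ 2) = sg k m * c m by rewrite divfK ?gt_eqF.
rewrite -mulrBl (mulrA 4) -mulrDl ler_pM2r//.
have : 8 * L ^+ 2 * (dyadic K / dyadic k) <= e.
  rewrite mulrA ler_pdivrMr ?dyadic_gt0//.
  rewrite ler_pdivlMr in hK; last by have := sqr_ge0 L; lra.
  by have := @dyadic_ge0 R K; nra.
have := sle N; rewrite /e in e0 ks k1' N1' *; lra.
Qed.

End QuotientL2.

(** * Maximal inequality on the dyadic tree *)

Section DyadicTree.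
Context {n : nat}.
Implicit Types (k l m q : nat).

(* The reduction modulo [2 ^ k] is vacuous for [k <= m]; it only makes [anc] total. *)
Definition anc k m (a : grid n m) : grid n k :=
  [ffun i => Ordinal (ltn_pmod (a i %/ 2 ^ (m - k)) (expn_gt0 2 k))].

(** Neighbouring cubes, the cube itself and diagonal neighbours included. Unlike for [grid_succ],
    there is no wrap-around. *)
Definition nearg k (c d : grid n k) :=
  [forall i, (c i <= (d i).+1)%N && (d i <= (c i).+1)%N].

Lemma ancE k m (a : grid n m) i : (k <= m)%N -> anc k a i = (a i %/ 2 ^ (m - k))%N :> nat.
Proof.
move=> km; rewrite ffunE/= modn_small// ltn_divLR ?expn_gt0//.
by rewrite -expnD subnKC.
Qed.

Lemma anc_anc k l m (a : grid n m) : (k <= l)%N -> (l <= m)%N -> anc k (anc l a) = anc k a.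
Proof.
move=> kl lm; apply/ffunP => i; apply/val_inj.
rewrite /= !ancE ?(leq_trans kl)// -divnMA -expnD; congr (_ %/ 2 ^ _)%N; lia.
Qed.

Lemma anc_id k (a : grid n k) : anc k a = a.
Proof. by apply/ffunP => i; apply/val_inj; rewrite /= ancE// subnn divn1. Qed.

Lemma near_anc k m (a b : grid n m) : (k <= m)%N -> nearg a b -> nearg (anc k a) (anc k b).
Proof.
move=> km /forallP ab; apply/forallP => i; have /andP[h1 h2] := ab i.
rewrite !ancE//; set d := (2 ^ (m - k))%N; have d0 : (0 < d)%N by rewrite expn_gt0.
have aux x y : (x <= y.+1)%N -> (x %/ d <= (y %/ d).+1)%N.
  move=> xy; have -> : (y %/ d).+1 = ((y + d) %/ d)%N.
    by rewrite divnDr ?dvdnn// divnn d0 addn1.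
  by apply: leq_div2r; lia.
by rewrite !aux.
Qed.

Lemma card_divn p d c : (c < p)%N -> (0 < d)%N ->
  #|[pred x : 'I_(p * d) | (x %/ d == c)%N]| = d.
Proof.
move=> cp d0.
have lt (y : 'I_d) : (c * d + y < p * d)%N by have := ltn_ord y; nia.
pose f y := Ordinal (lt y).
have fi : injective f by move=> x y [] /addnI; apply: val_inj.
rewrite -[RHS](card_ord d) -(fintype.card_image fi).
apply: eq_card => x; rewrite !inE; apply/eqP/fintype.imageP => [xc|[y _ ->]] /=; last first.
  by rewrite divnMDl// divn_small// addn0.
have xd : (x %% d < d)%N by rewrite ltn_mod.
by exists (Ordinal xd) => //; apply: val_inj; rewrite /= -xc -divn_eq.
Qed.

Lemma card_ffun_family (T : finType) (F : 'I_n -> pred T) (P : pred {ffun 'I_n -> T}) d :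
  (forall a, P a = [forall i, F i (a i)]) -> (forall i, #|F i| <= d)%N -> (#|[pred a | P
    a]| <= d ^ n)%N.
Proof.
move=> PF Fd; rewrite (eq_card (_ : _ =i family F)); last first.
  by move=> a; rewrite !unfold_in PF; apply: eq_forallb => i; rewrite -topredE.
rewrite card_family foldrE big_map big_enum/=.
by rewrite -[X in (_ <= _ ^ X)%N]card_ord -prod_nat_const leq_prod.
Qed.

Lemma card_cube k m (c : grid n k) : (k <= m)%N ->
  #|[pred a : grid n m | anc k a == c]| = ((2 ^ (m - k)) ^ n)%N.
Proof.
move=> km; pose F i := [pred x : 'I_(2 ^ m) | (x %/ 2 ^ (m - k) == c i)%N].
rewrite (eq_card (_ : _ =i family F)); last first.
  move=> a; rewrite !unfold_in/=; apply/eqP/forallP => [ac i|H].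
    by rewrite inE -ac ancE.
  by apply/ffunP => i; apply/val_inj; rewrite /= ancE//; apply/eqP; apply: H.
rewrite card_family foldrE big_map big_enum/=.
rewrite (eq_bigr (fun=> (2 ^ (m - k))%N)); last first.
  move=> i _; rewrite /F.
  have : (2 ^ m = 2 ^ k * 2 ^ (m - k))%N by rewrite -expnD subnKC.
  move: (2 ^ m)%N => M ->; apply: card_divn; by [rewrite expn_gt0|].
by rewrite prod_nat_const card_ord.
Qed.

Lemma card_nearg k (c : grid n k) : (#|[pred d | nearg c d]| <= 3 ^ n)%N.
Proof.
pose F i (x : 'I_(2 ^ k)) := (c i <= x.+1)%N && (x <= (c i).+1)%N.
apply: (@card_ffun_family _ F) => // i.
rewrite cardE -(size_map val); apply: (@uniq_leq_size _ _ [:: (c i).-1; c i : nat; (c i).+1]).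
  by rewrite map_inj_uniq ?enum_uniq//; apply: val_inj.
move=> _ /mapP[x + ->]; rewrite mem_enum unfold_in/= !inE; lia.
Qed.

Lemma card_near_cube k m (c : grid n k) : (k <= m)%N ->
  (#|[pred a : grid n m | nearg c (anc k a)]| <= 3 ^ n * (2 ^ (m - k)) ^ n)%N.
Proof.
move=> km; rewrite -sum1_card (partition_big (@anc k m) (fun d => nearg c d))//=.
apply: (@leq_trans (\sum_(d : grid n k | nearg c d) (2 ^ (m - k)) ^ n)).
  apply: leq_sum => d cd; rewrite -(card_cube d km) -sum1_card.
  by apply: eq_leq; apply: eq_bigl => a; rewrite !inE; case: eqP => [->|]; rewrite ?cd ?andbF.
by rewrite sum_nat_const leq_mul2r card_nearg orbT.
Qed.

Section Maximal.
Context {R : realType}.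
Variables (q m : nat) (qm : (q <= m)%N) (viol : forall k, pred (grid n k)).
Variables (W : grid n m -> R) (t : R).
Arguments viol {k}.
Hypothesis W0 : forall a, 0 <= W a.
Hypothesis violW : forall k (c : grid n k), (k <= q)%N -> viol c ->
  t * ((2 ^ (m - k)) ^ n)%:R <= \sum_(a | anc k a == c) W a.
Hypothesis t0 : 0 <= t.

Definition near_viol (a : grid n m) :=
  [exists k : 'I_q.+1, [exists c : grid n k, viol c && nearg c (anc k a)]].

(** The coarsest violating cubes, as in a Calderon-Zygmund decomposition: none contains another, so
    they share no grid points. *)
Let first k (c : grid n k) := viol c && [forall j : 'I_k, ~~ viol (anc j c)].

Let near_viol_first a : near_viol a ->
  [exists k : 'I_q.+1, [exists c : grid n k, first c && nearg c (anc k a)]].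
Proof.
move=> /existsP[k /existsP[c /andP[vc ca]]].
have ex : exists j, (j <= k)%N && viol (anc j c) by exists k; rewrite leqnn anc_id.
case: (ex_minnP ex) => j /andP[jk vj] jmin.
have jq : (j < q.+1)%N by rewrite ltnS (leq_trans jk)// -ltnS.
apply/existsP; exists (Ordinal jq); apply/existsP; exists (anc j c) => /=.
apply/andP; split.
  apply/andP; split => //; apply/forallP => i; apply/negP.
  rewrite anc_anc ?(ltnW (ltn_ord i))// => vi.
  by have := jmin i; rewrite vi (leq_trans (ltnW (ltn_ord i)) jk) leqNgt ltn_ord => /(_ isT).
rewrite -(@anc_anc j k m) ?(leq_trans _ qm)// ?(leq_trans (ltn_ord k))//; last by rewrite
  -ltnS.
exact: near_anc.
Qed.

Let first_uniq (a : grid n m) (j k : 'I_q.+1) :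
  first (anc j a) -> first (anc k a) -> j = k.
Proof.
have km (k' : 'I_q.+1) : (k' <= m)%N by rewrite (leq_trans _ qm)// -ltnS.
wlog jk : j k / (j <= k)%N => [wl|].
  by case: (leqP j k) => [/wl//|/ltnW /wl w A B]; exact/esym/w.
move=> /andP[vj _] /andP[_ /forallP vk]; apply/val_inj/eqP.
rewrite eqn_leq jk leqNgt; apply/negP => kj.
by have := vk (Ordinal kj); rewrite /= anc_anc// vj.
Qed.

(** Weak type bound. Each counted point lies in a coarsest violating cube or in one of its
    neighbours, at most [3 ^ n] cubes in all. The coarsest violating cubes are disjoint, so [t]
    times their total number of points is at most the mass of [W]. *)
Lemma near_viol_card : t * #|near_viol|%:R <= (3 ^ n)%:R * \sum_a W a.
Proof.
have km (k : 'I_q.+1) : (k <= m)%N by rewrite (leq_trans _ qm)// -ltnS.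
have step1 : (#|near_viol| <= \sum_(k < q.+1) \sum_(c : grid n k | first c)
    3 ^ n * (2 ^ (m - k)) ^ n)%N.
  rewrite -sum1_card; apply: (@leq_trans (\sum_(a : grid n m) \sum_(k < q.+1)
      \sum_(c : grid n k | first c) nearg c (anc k a))).
    rewrite big_mkcond/=; apply: leq_sum => a _; case: ifP => // /near_viol_first.
    move=> /existsP[k /existsP[c /andP[fc ca]]].
    by rewrite (bigD1 k)//= (bigD1 c)//= ca.
  rewrite exchange_big/=; apply: leq_sum => k _; rewrite exchange_big/=.
  apply: leq_sum => c _; apply: leq_trans (card_near_cube c (km k)).
  rewrite -sum1_card [in X in (_ <= X)%N]big_mkcond/=; apply: leq_sum => a _.
  by rewrite ?inE; case: (nearg _ _).
have step2 : \sum_(k < q.+1) \sum_(c : grid n k | first c) t * ((2 ^ (m - k)) ^ n)%:R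
    <= \sum_a W a.
  apply: (@le_trans _ _ (\sum_(k < q.+1) \sum_(c : grid n k | first c)
      \sum_(a | anc k a == c) W a)).
    by apply: ler_sum => k _; apply: ler_sum => c /andP[vc _];
      exact: (violW (ltn_ord k) vc).
  apply: (@le_trans _ _ (\sum_(k < q.+1) \sum_(a | first (anc k a)) W a)).
    apply: ler_sum => k _.
    by rewrite [leRHS](partition_big (@anc k m) (fun c => first c))//=; apply: ler_sum => c fc;
      rewrite le_eqVlt; apply/orP; left; apply/eqP; apply: eq_bigl => a; case: eqP =>
        [->|]; rewrite ?fc ?andbF.
  rewrite (eq_bigr (fun k : 'I_q.+1 => \sum_a (if first (anc k a) then W a else 0)));
    last first.
    by move=> k _; rewrite big_mkcond.
  rewrite exchange_big/=; apply: ler_sum => a _.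
  have [/existsP[k fk]|/existsPn nf] := boolP [exists k : 'I_q.+1, first (anc k a)].
    rewrite (bigD1 k)//= fk big1 ?addr0// => j jk; case: ifP => // fj.
    by rewrite (first_uniq fj fk) eqxx in jk.
  by rewrite big1// => k _; rewrite (negbTE (nf k)).
apply: le_trans (ler_wpM2l (ler0n R (3 ^ n)) step2).
rewrite -(ler_nat R) in step1; apply: (le_trans (ler_wpM2l t0 step1)).
rewrite !natr_sum !mulr_sumr; apply: ler_sum => k _; rewrite natr_sum !mulr_sumr.
by apply: ler_sum => c _; rewrite natrM mulrCA.
Qed.

End Maximal.
End DyadicTree.

(** * Points of small mean oscillation *)

Section Selection.
Context {R : realType} {n : nat}.
Implicit Types (k m q : nat) (x : 'rV[R]_n).

Definition cube_sum k m (d : grid n k) (G : 'rV[R]_n -> R) : R :=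
  \sum_(a : grid n m | anc k a == d) G (gpoint a).

Definition in_cube k (c : grid n k) x :=
  forall i, (c i)%:R * dyadic k <= x 0 i <= (c i).+1%:R * dyadic k.

Lemma gpoint_in_cube k m (a : grid n m) : (k <= m)%N -> in_cube (anc k a) (gpoint a).
Proof.
move=> km i; rewrite mxE (dyadicE km) !mulrA -!natrM.
rewrite !ler_wpM2r ?dyadic_ge0// ler_nat ancE// ?leq_trunc_div//.
by rewrite mulnC ltnW// mulnC ltn_ceil// expn_gt0.
Qed.

Variables (U : set_system nat).
Hypothesis (UU : UltraFilter U) (ooU : \oo `<=` U).
Variables (W : nat -> nat -> 'rV[R]_n -> R) (thr eta : nat -> R).
Variables (S : set 'rV[R]_n) (c0 : R).
Hypothesis W0 : forall j N x, 0 <= W j N x.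
Hypothesis thr0 : forall j, 0 < thr j.
Hypothesis Weta : forall j, \forall N \near U, \forall m \near U,
  gsum m (W j N) <= eta j * ((2 ^ m) ^ n)%:R.
Hypothesis Sc0 : \forall m \near U,
  c0 * ((2 ^ m) ^ n)%:R <= #|[pred a : grid n m | `[< S (gpoint a) >]]|%:R.
Hypothesis ltc0 : forall q, \sum_(j < q) ((3 ^ n)%:R * eta j / thr j) < c0.

(** [low] and [high] concern all finer grids along [U], yet they exhaust all cases because [U] is an
    ultrafilter. Being [high] is therefore a property of the cube alone, to which the maximal
    inequality applies in one fixed grid. *)
Let low j k (d : grid n k) := \forall N \near U, \forall m \near U,
  cube_sum m d (W j N) <= thr j * ((2 ^ (m - k)) ^ n)%:R.

Let high j k (d : grid n k) := \forall N \near U, \forall m \near U,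
  thr j * ((2 ^ (m - k)) ^ n)%:R <= cube_sum m d (W j N).

Let not_high j k (d : grid n k) : ~ high j d -> low j d.
Proof.
move=> nh; have [hd|] := in_ultra_setVsetC [set N | \forall m \near U,
  thr j * ((2 ^ (m - k)) ^ n)%:R <= cube_sum m d (W j N)] UU; first by case: nh.
apply: filterS => N /= nN.
have [hd|] := in_ultra_setVsetC [set m | 
  thr j * ((2 ^ (m - k)) ^ n)%:R <= cube_sum m d (W j N)] UU; first by case: nN.
by apply: filterS => m /= /negP; rewrite -ltNge => /ltW.
Qed.

(** There are finitely many cubes down to depth [q], so a single [N] and a single [m] realise all
    [high] inequalities at once. In that grid the points near a [high] cube have proportion less
    than [c0], and some point of [S] avoids them; what it satisfies no longer refers to this [N] and
    [m]. *)
Lemma select_points q : exists2 x, S x & forall k, (k <= q)%N ->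
  exists2 c : grid n k, in_cube c x &
  forall d : grid n k, nearg d c -> forall j, (j < q)%N ->
  \forall N \near U, \forall m \near U,
    cube_sum m d (W j N) <= thr j * ((2 ^ (m - k)) ^ n)%:R.
Proof.
have geU k : \forall m \near U, (k <= m)%N by apply: ooU; exists k.
have [N [N1 N2]] : exists N, 
    (forall j : 'I_q, \forall m \near U, gsum m (W j N) <= eta j * ((2 ^ m) ^ n)%:R) /\
    (forall (j : 'I_q) (k : 'I_q.+1) (d : grid n k), \forall m \near U,
       high j d -> thr j * ((2 ^ (m - k)) ^ n)%:R <= cube_sum m d (W j N)).
  apply: (@filter_ex _ U); near=> N; split; first by near: N; exact: filter_forall.
  near: N; apply: filter_forall => j; apply: filter_forall => k; apply: filter_forall => d.
  have [hd|nhd] := pselect (high j d); last by do 2 apply: nearW => ?.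
  by apply: filterS hd => N; apply: filterS.
have [m [qm M1 M2 M3]] : exists m, [/\ (q <= m)%N,
    forall j : 'I_q, gsum m (W j N) <= eta j * ((2 ^ m) ^ n)%:R,
    forall (j : 'I_q) (k : 'I_q.+1) (d : grid n k),
       high j d -> thr j * ((2 ^ (m - k)) ^ n)%:R <= cube_sum m d (W j N) &
    c0 * ((2 ^ m) ^ n)%:R <= #|[pred a : grid n m | `[< S (gpoint a) >]]|%:R].
  apply: (@filter_ex _ U); near=> m; split.
  - by near: m.
  - by near: m; exact: filter_forall.
  - near: m; apply: filter_forall => j; apply: filter_forall => k.
    by apply: filter_forall => d.
  - by near: m.
pose bad (j : 'I_q) := [pred a : grid n m | near_viol q (fun k d => `[< high j d >]) a].
have badc (j : 'I_q) : #|bad j|%:R <= (3 ^ n)%:R * eta j / thr j * ((2 ^ m) ^ n)%:R :> R.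
  rewrite [leRHS]mulrAC ler_pdivlMr// [leLHS]mulrC.
  apply: le_trans (near_viol_card qm (W := fun a => W j N (gpoint a)) _ _ (ltW (thr0 j)))
    _ => //.
    move=> k c kq /asboolP hc.
    exact: (M2 j (Ordinal (kq : (k < q.+1)%N)) c).
  by rewrite -mulrA ler_wpM2l// M1.
have [a /andP[Sa /existsPn nb]] : exists a, `[< S (gpoint a) >] && ~~ [exists j, bad j a].
  apply: contrapT => /forallNP no.
  have : (#|[pred a : grid n m | `[< S (gpoint a) >]]| <= \sum_(j < q) #|bad j|)%N.
    rewrite -sum1_card big_mkcond/=.
    under [X in (_ <= X)%N]eq_bigr do rewrite -sum1_card big_mkcond/=.
    rewrite exchange_big/=; apply: leq_sum => a _; rewrite inE; case: ifP => // Sa.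
    have /negP := no a; rewrite Sa/= negbK => /existsP[j bj].
    by rewrite (bigD1 j)//= {1}/in_mem/= bj.
  rewrite -(ler_nat R) natr_sum => /(le_trans M3)/le_trans.
  move=> /(_ _ (ler_sum _ (fun j _ => badc j))); rewrite -mulr_suml ler_pM2r.
    by rewrite leNgt ltc0.
  by rewrite ltr0n !expn_gt0.
exists (gpoint a) => [|k kq]; first exact/asboolP.
have km := leq_trans kq qm.
exists (anc k a); first exact: gpoint_in_cube.
move=> d dc j jq; apply: not_high => hd.
have /negP := nb (Ordinal jq); apply; apply/existsP; exists (Ordinal (kq : (k < q.+1)%N)).
by apply/existsP; exists d; rewrite dc andbT; apply/asboolP.
Unshelve. all: by end_near. Qed.

End Selection.

(** * Almost affine behaviour *)

Section Poincare.
Context {R : realType} {n : nat}.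
Implicit Types (k l m N : nat) (x y z p : 'rV[R]_n).

Lemma gpoint_inj m : injective (@gpoint R n m).
Proof.
move=> a b /rowP ab; apply/ffunP => i; apply/val_inj; have := ab i.
by rewrite !mxE => /(mulIf (lt0r_neq0 (dyadic_gt0 m)))/eqP; rewrite eqr_nat => /eqP.
Qed.

Lemma exists_cube M y : (forall j, 0 <= y 0 j < 1) -> exists w : grid n M, in_cube w y.
Proof.
move=> y01; have y0 j : 0 <= y 0 j * (2 ^ M)%:R by have /andP[? _] := y01 j; rewrite mulr_ge0.
have lt j : (Num.trunc (y 0 j * (2 ^ M)%:R)%R < 2 ^ M)%N.
  rewrite truncn_lt_nat// gtr_pMl ?ltr0n ?expn_gt0//.
  by have /andP[] := y01 j.
exists [ffun j => Ordinal (lt j)] => j; rewrite ffunE/=.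
have /andP[h1 h2] := truncn_itv (y0 j).
have E : y 0 j = y 0 j * (2 ^ M)%:R * dyadic M by rewrite -mulrA dyadic_pow mulr1.
apply/andP; split; first by rewrite [leRHS]E ler_wpM2r ?dyadic_ge0.
by rewrite [leLHS]E ler_wpM2r ?dyadic_ge0// ltW.
Qed.

Lemma exists_gpoint m x (u : 'I_n -> nat) : (forall j, x 0 j = (u j)%:R * dyadic m) ->
  (forall j, x 0 j < 1) -> exists a : grid n m, gpoint a = x.
Proof.
move=> xu x1; have lt j : (u j < 2 ^ m)%N.
  rewrite -(ltr_nat R) -(ltr_pM2r (dyadic_gt0 m)) dyadic_pow -xu//.
by exists [ffun j => Ordinal (lt j)]; apply/rowP => j; rewrite !mxE ffunE xu.
Qed.

Lemma sum_shift_le m (P Q : pred (grid n m)) (F : 'rV[R]_n -> R) (v : 'rV[R]_n) :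
  (forall x, 0 <= F x) -> (forall a, P a -> exists2 b, Q b & gpoint b = gpoint a + v) ->
  \sum_(a | P a) F (gpoint a + v) <= \sum_(b | Q b) F (gpoint b).
Proof.
move=> F0 H.
have /choice[h hP] a : exists b, P a -> Q b /\ gpoint b = gpoint a + v.
  have [/H[b ? ?]|_] := boolP (P a); first by exists b.
  by exists a.
rewrite (partition_big h Q)/=; last by move=> a /hP[].
apply: ler_sum => b Qb; have [a /andP[Pa /eqP ab]|no] := pickP (fun a => P a && (h a == b)).
  rewrite (bigD1 a) ?Pa ?ab ?eqxx//= big1 ?addr0.
    by have [_ <-] := hP a Pa; rewrite ab.
  move=> a' /andP[/andP[Pa' /eqP ab'] /negP[]]; apply/eqP/gpoint_inj.
  have [_ E] := hP a Pa; have [_ E'] := hP a' Pa'.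
  by apply: (addIr v); rewrite -E -E' ab ab'.
by rewrite big1// => a; rewrite no.
Qed.

(** A point at most 3/4 of a side outside the cube [c] cannot lie two cubes away. The 3/4 is made of
    the 1/4 allowed between [p] and its cube and the 1/2 allowed between [p] and the points of a
    path. *)
Lemma nearg_gpoint k m (c : grid n k) (a : grid n m) : (k <= m)%N ->
  (forall j, (c j)%:R * dyadic k - 3 / 4 * dyadic k <= (gpoint a : 'rV[R]_n) 0 j
             <= (c j)%:R * dyadic k + 7 / 4 * dyadic k) -> nearg (anc k a) c.
Proof.
move=> km H; apply/forallP => j; have := gpoint_in_cube (R := R) a km j.
have := H j; move: (gpoint a 0 j) => x; move: (anc k a j : nat) (c j : nat) => e f.
rewrite -!mulrDl -mulrBl => /andP[A B] /andP[C D].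
have := le_trans C B; have := le_trans A D; rewrite !ler_pM2r ?dyadic_gt0// => E F.
rewrite -natr1 in E.
by apply/andP; split; rewrite leqNgt; apply/negP; rewrite -(ler_nat R) -!natr1; lra.
Qed.

Variables (U : set_system nat).
Hypothesis (UU : UltraFilter U) (ooU : \oo `<=` U).
Variables (G : 'rV[R]_n -> R) (L : R) (i : 'I_n).
Hypothesis lipG : forall x y, `|G x - G y| <= L * `|x - y|.
Variables (k l : nat) (c : grid n k) (p : 'rV[R]_n) (A theta : R).
Hypothesis l2 : (2 <= l)%N.
Hypothesis theta0 : 0 < theta.
Hypothesis AL : `|A| <= L.
Hypothesis pc : forall j, (c j)%:R * dyadic k - dyadic k / 4 <= p 0 j
  <= (c j)%:R * dyadic k + 5 / 4 * dyadic k.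
Hypothesis p01 : forall j, dyadic k <= p 0 j <= 1 - dyadic k.
Hypothesis low : forall d : grid n k, nearg d c -> 
  \forall N \near U, \forall m \near U,
  cube_sum m d (fun x => (dquot N i G x - A) ^+ 2) <= theta ^+ 2 * ((2 ^ (m - k)) ^ n)%:R.

Lemma dquot_telescope N s z : G (z + (s%:R * dyadic N) *: evec i) - G z - s%:R * dyadic N * A =
  dyadic N * \sum_(s' < s) (dquot N i G (z + (s'%:R * dyadic N) *: evec i) - A).
Proof.
elim: s => [|s IH]; first by rewrite big_ord0 !mul0r scale0r addr0 subrr mulr0 subr0.
rewrite big_ord_recr/= mulrDr -IH /dquot mulrBr mulrCA mulfV ?gt_eqF ?dyadic_gt0// mulr1.
rewrite -[s.+1%:R]natr1 mulrDl mul1r scalerDl addrA; ring.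
Qed.

(** The left-hand side is a telescoping sum of [dquot N i G - A] along one line, which a mean square
    bound does not control. Averaging over starting points in a cube of side [dyadic (k + l)] around
    [y] thickens the line to a tube. This costs a displacement error proportional to [dyadic l] and
    the volume ratio [(2 ^ l) ^ n]. *)
Lemma poincare_axis y (t : R) : 0 <= t -> `|y - p| <= dyadic k / 4 ->
  `|y + t *: evec i - p| <= dyadic k / 4 ->
  `|G (y + t *: evec i) - G y - t * A| <=
    (theta * ((3 ^ n * (2 ^ l) ^ n)%:R) + 4 * L * dyadic l) * dyadic k.
Proof.
move=> t0 yp ytp; have L0 : 0 <= L := le_trans (normr_ge0 _) AL.
have geU q : \forall m \near U, (q <= m)%N by apply: ooU; exists q.
have lowN : \forall N \near U, forall d : grid n k, nearg d c -> \forall m \near U,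
    cube_sum m d (fun x => (dquot N i G x - A) ^+ 2) <= theta ^+ 2 * ((2 ^ (m - k)) ^ n)%:R.
  apply: filter_forall => d; have [dc|] := boolP (nearg d c); last by move=> _; exact: nearW.
  by apply: filterS (low dc).
have [N [klN lN]] := filter_ex (filterI (geU (k + l)%N) lowN).
have lowm : \forall m \near U, forall d : grid n k, nearg d c -> 
    cube_sum m d (fun x => (dquot N i G x - A) ^+ 2) <= theta ^+ 2 * ((2 ^ (m - k)) ^ n)%:R.
  apply: filter_forall => d; have [dc|] := boolP (nearg d c); last by move=> _; exact: nearW.
  by apply: filterS (lN d dc).
have [m [Nm lm]] := filter_ex (filterI (geU N) lowm).
have h0 := @dyadic_gt0 R k.
have km : (k <= m)%N by rewrite (leq_trans _ Nm)// (leq_trans _ klN)// leq_addr.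
have hN0 := @dyadic_gt0 R N.
have hklE : dyadic (k + l) = dyadic k * dyadic l :> R by rewrite /dyadic exprD.
have hl4 : dyadic l <= 4^-1 :> R.
  by apply: le_trans (dyadic_le l2) _; rewrite /dyadic; lra.
have ypj j : `|y 0 j - p 0 j| <= dyadic k / 4.
  by have := mx_entry_le (y - p) 0 j; rewrite !mxE; lra.
have ytpi : `|y 0 i + t - p 0 i| <= dyadic k / 4.
  have := mx_entry_le (y + t *: evec i - p) 0 i; rewrite !mxE !eqxx mulr1; lra.
have th : t <= dyadic k / 2.
  by move: (ypj i) ytpi; rewrite !ler_norml => /andP[? ?] /andP[? ?]; lra.
have [w yw] : exists w : grid n (k + l), in_cube w y.
  apply: exists_cube => j; have := ypj j; have := p01 j.
  by rewrite ler_norml => /andP[? ?] /andP[? ?]; apply/andP; split; lra.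
pose s := Num.trunc (t / dyadic N).
have /andP[s1 s2] : s%:R <= t / dyadic N < s.+1%:R by apply: truncn_itv; rewrite
  divr_ge0// ltW.
rewrite ler_pdivlMr// in s1; rewrite ltr_pdivrMr// -natr1 mulrDl mul1r in s2.
pose win : pred (grid n m) := [pred a | anc (k + l) a == w].
pose F x := `|dquot N i G x - A|.
have zy a : win a -> forall j, `|gpoint a 0 j - y 0 j| <= dyadic k * dyadic l.
  move=> /eqP aw j; have := gpoint_in_cube (R := R) a (leq_trans klN Nm) j.
  rewrite aw; have := yw j; rewrite -hklE -natr1 mulrDl mul1r ler_norml.
  by move=> /andP[? ?] /andP[? ?]; apply/andP; split; lra.
have shift (s' : 'I_s) a : win a -> exists2 b : grid n m, nearg (anc k b) c &
    gpoint b = gpoint a + (s'%:R * dyadic N) *: evec i :> 'rV[R]_n.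
  move=> wa; have s't : s'%:R * dyadic N <= t.
    by apply: le_trans s1; rewrite ler_pM2r// ler_nat ltnW.
  have s'0 : 0 <= s'%:R * dyadic N :> R by rewrite mulr_ge0// ltW.
  set x := _ + _; have xp j : `|x 0 j - p 0 j| <= dyadic k / 2.
    have := zy a wa j; have := ypj j; rewrite /x !mxE eqxx/=.
    have : dyadic k * dyadic l <= dyadic k / 4 :> R by rewrite ler_pM2l.
    case: eqP => [->|_]; rewrite ?mulr1 ?mulr0 ?addr0 ?ler_norml;
      move: ytpi; rewrite ler_norml => /andP[? ?] ? /andP[? ?] /andP[? ?];
      apply/andP; split; lra.
  have [b bx] : exists b : grid n m, gpoint b = x.
    apply: (@exists_gpoint _ _ (fun j => a j + (j == i) * (s' * 2 ^ (m - N)))%N) => j.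
      rewrite /x !mxE eqxx/= (dyadicE Nm) natrD mulrDl; congr (_ + _).
      by case: eqP => _; rewrite ?mulr0 ?mul0n ?mul0r// mulr1 mul1n natrM mulrA.
    by have := xp j; have /andP[? ?] := p01 j; rewrite ler_norml => /andP[? ?]; lra.
  exists b => //; apply: nearg_gpoint => // j; rewrite bx.
  have /andP[? ?] := pc j; have := xp j; rewrite ler_norml => /andP[? ?].
  by apply/andP; split; lra.
pose kap : R := ((2 ^ (m - k)) ^ n)%:R.
have kap0 : 0 < kap by rewrite ltr0n !expn_gt0.
(* [F] is at most [theta] plus [theta^-1] times its square, so the mean square bound gives mean at
   most [2 * theta] in each of at most [3 ^ n] cubes. *)
have nearF : \sum_(b : grid n m | nearg (anc k b) c) F (gpoint b) <= 2 * theta * (3 ^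
  n)%:R * kap.
  have FX x : F x <= theta + theta^-1 * (dquot N i G x - A) ^+ 2.
    rewrite -(ler_pM2l theta0) mulrDr mulrA mulfV ?gt_eqF// mul1r.
    rewrite -[X in _ + X]real_normK ?num_real// /F.
    by have := sqr_ge0 (theta - `|dquot N i G x - A|); have := normr_ge0 (dquot N i G x -
      A); nra.
  rewrite (partition_big (@anc n k m) (fun d => nearg d c))//=.
  apply: (@le_trans _ _ (\sum_(d : grid n k | nearg d c) 2 * theta * kap)).
    apply: ler_sum => d dc.
    apply: (@le_trans _ _ (\sum_(b : grid n m | anc k b == d) (theta + theta^-1 * (dquot
      N i G (gpoint b) - A) ^+ 2))).
      rewrite [leLHS](_ : _ = \sum_(b : grid n m | anc k b == d) F (gpoint b)).
        by apply: ler_sum => b _; exact: FX.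
      by apply: eq_bigl => b; case: eqP => [->|]; rewrite ?dc ?andbF.
    rewrite big_split/= sumr_const -mulr_sumr (card_cube d km) -/(cube_sum m d _).
    have := lm d dc; rewrite -/kap -[theta *+ _]mulr_natr -/kap => cs.
    have : theta^-1 * cube_sum m d (fun x => (dquot N i G x - A) ^+ 2) <= theta * kap.
      by rewrite ler_pdivrMl// mulrA -expr2.
    by rewrite /cube_sum; lra.
  rewrite sumr_const -[leLHS]mulr_natr mulrAC; rewrite ler_pM2r// ler_pM2l ?mulr_gt0// ler_nat.
  have := card_nearg c; congr (_ <= _)%N; apply: eq_card => d; rewrite !unfold_in/=.
  by apply: eq_forallb => j; rewrite andbC.
pose E := `|G (y + t *: evec i) - G y - t * A|.
(* Four errors of size at most [L * dyadic (k + l)]: two for moving both end points from [y] to the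
   grid point [z], and two for rounding [t] down to a multiple of [dyadic N]. *)
have EE a : win a -> E <= dyadic N * \sum_(s' < s) F (gpoint a + (s'%:R * dyadic N) *: evec i)
   + 4 * L * (dyadic k * dyadic l).
  move=> wa; have := dquot_telescope N s (gpoint a); set z := gpoint a => tel.
  have zyn : `|z - y| <= dyadic k * dyadic l.
    apply: mx_norm_leP => [|r j]; first by rewrite mulr_ge0 ?dyadic_ge0.
    by rewrite !mxE ord1; have := zy a wa j; rewrite mxE.
  have e1 : `|G y - G z| <= L * (dyadic k * dyadic l).
    by apply: le_trans (lipG _ _) _; rewrite distrC ler_wpM2l.
  have e2 : `|G (y + t *: evec i) - G (z + (s%:R * dyadic N) *: evec i)| <=
      L * (dyadic k * dyadic l) + L * dyadic N.
    apply: le_trans (lipG _ _) _; rewrite -mulrDr ler_wpM2l// opprD addrACA -scalerBl.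
    apply: le_trans (ler_normD _ _) _; rewrite distrC lerD// norm_evec ger0_norm; lra.
  have e3 : `|(t - s%:R * dyadic N) * A| <= dyadic N * L.
    by rewrite normrM ler_pM// ger0_norm; lra.
  have hNkl : L * dyadic N <= L * (dyadic k * dyadic l) by rewrite ler_wpM2l// -hklE dyadic_le.
  have e4 : `|G (z + (s%:R * dyadic N) *: evec i) - G z - s%:R * dyadic N * A| <=
     dyadic N * \sum_(s' < s) F (z + (s'%:R * dyadic N) *: evec i).
    by rewrite tel normrM gtr0_norm// ler_pM2l//; apply: ler_norm_sum.
  rewrite /E; move: e1 e2 e3 e4; set S := _ * \sum_(_ < _) _.
  set a1 := G (y + _); set a2 := G (z + _).
  rewrite !ler_norml => /andP[? ?] /andP[? ?] /andP[? ?] /andP[? ?].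
  by apply/andP; split; lra.
have cw : #|win|%:R = ((2 ^ (m - (k + l))) ^ n)%:R :> R by rewrite (card_cube w
  (leq_trans klN Nm)).
have kapE : kap = ((2 ^ l) ^ n)%:R * #|win|%:R.
  have mkl : (m - k = l + (m - (k + l)))%N by clear -klN Nm; lia.
  by rewrite cw /kap mkl expnD expnMn natrM.
have w0 : 0 < #|win|%:R :> R by rewrite cw ltr0n !expn_gt0.
have : #|win|%:R * E <= t * (2 * theta * (3 ^ n)%:R * kap) + #|win|%:R * (4 * L * (dyadic
  k * dyadic l)).
  have sw (u : R) : #|win|%:R * u = \sum_(a | win a) u by rewrite sumr_const mulr_natl.
  rewrite !sw; apply: le_trans (ler_sum _ EE) _; rewrite big_split/= lerD2r.
  rewrite -mulr_sumr exchange_big/=.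
  apply: (@le_trans _ _ (dyadic N * \sum_(s' < s) (2 * theta * (3 ^ n)%:R * kap))).
    rewrite ler_pM2l//; apply: ler_sum => s' _; apply: le_trans nearF.
    by apply: sum_shift_le => [x|]; [rewrite /F|exact: shift].
  rewrite sumr_const card_ord -[_ *+ s]mulr_natl mulrA ler_pM2r; first by rewrite mulrC.
  by rewrite !mulr_gt0// ltr0n expn_gt0.
rewrite kapE -/E; set w' : R := #|win|%:R; rewrite -/w' in w0.
have -> : t * (2 * theta * (3 ^ n)%:R * (((2 ^ l) ^ n)%:R * w')) + w' * (4 * L * (dyadic
  k * dyadic l))
  = w' * (2 * t * (theta * (3 ^ n * (2 ^ l) ^ n)%:R) + 4 * L * (dyadic k * dyadic l)).
  by rewrite natrM; ring.
rewrite ler_pM2l// => /le_trans; apply.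
set M := theta * _; have M0 : 0 <= M by rewrite mulr_ge0// ltW.
rewrite [leRHS](_ : _ = dyadic k * M + 4 * L * (dyadic k * dyadic l)); last by ring.
rewrite lerD2r ler_wpM2r//; lra.
Qed.

End Poincare.

Section LocalApprox.
Context {R : realType} {n q : nat}.
Variables (U : set_system nat).
Hypothesis (UU : UltraFilter U) (ooU : \oo `<=` U).
Variables (g : 'rV[R]_n -> 'rV[R]_q) (L : R).
Hypothesis L0 : 0 <= L.
Hypothesis lipg : forall x y, `|g x - g y| <= L * `|x - y|.
Hypothesis perg : zperiodic g.
Implicit Types (k l m N K : nat) (x y p v : 'rV[R]_n).

Definition jac_quot K x : 'M[R]_(n, q) :=
  \matrix_(i, j) dquot K i (fun y => g y 0 j) x.

Definition jac_osc K N x : R :=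
  \sum_i \sum_j (jac_quot N x i j - jac_quot K x i j) ^+ 2.

Lemma lip_comp j x y : `|g x 0 j - g y 0 j| <= L * `|x - y|.
Proof.
apply: le_trans (lipg x y).
by have := mx_entry_le (g x - g y) 0 j; rewrite !mxE.
Qed.

Lemma periodic_comp j : zperiodic (fun y => g y 0 j).
Proof. by move=> i x; rewrite perg. Qed.

Lemma jac_osc_ge0 K N x : 0 <= jac_osc K N x.
Proof. by apply: sumr_ge0 => i _; apply: sumr_ge0 => j _; exact: sqr_ge0. Qed.

Lemma jac_osc_small (eta : R) : 0 < eta -> exists K0, forall K N, (K0 <= K)%N -> (K <= N)%N ->
  \forall m \near U, gsum m (jac_osc K N) <= eta * ((2 ^ m) ^ n)%:R.
Proof.
move=> eta0; pose e := eta / (n * q).+1%:R; have e0 : 0 < e by rewrite divr_gt0.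
have /choice[K0 K0P] (ij : 'I_n * 'I_q) : exists K0, forall K N, (K0 <= K)%N -> (K <= N)%N ->
    \forall m \near U, gsum m (fun x => (jac_quot N x ij.1 ij.2 - jac_quot K x ij.1 ij.2) ^+ 2)
    <= e * ((2 ^ m) ^ n)%:R.
  have [K0 K0P] := dquot_cauchy (lip_comp ij.2) (periodic_comp ij.2) ij.1 UU ooU e0.
  exists K0 => K N K0K KN; apply: filterS (K0P K N K0K KN) => m.
  by apply: le_trans; apply: ler_gsum => x; rewrite !mxE.
exists (\max_ij K0 ij) => K N K0K KN.
have : \forall m \near U, forall ij : 'I_n * 'I_q,
    gsum m (fun x => (jac_quot N x ij.1 ij.2 - jac_quot K x ij.1 ij.2) ^+ 2)
    <= e * ((2 ^ m) ^ n)%:R.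
  by apply: filter_forall => ij; apply: K0P => //; apply: leq_trans K0K; apply: leq_bigmax.
apply: filterS => m H.
have -> : gsum m (jac_osc K N) = \sum_(ij : 'I_n * 'I_q)
    gsum m (fun x => (jac_quot N x ij.1 ij.2 - jac_quot K x ij.1 ij.2) ^+ 2).
  rewrite /gsum [RHS]exchange_big/=; apply: eq_bigr => a _.
  by rewrite /jac_osc pair_big.
apply: le_trans (ler_sum _ (fun ij _ => H ij)) _.
rewrite sumr_const card_prod !card_ord -[leLHS]mulr_natl mulrA ler_wpM2r//.
by rewrite /e mulrCA ler_piMr ?(ltW eta0)// ler_pdivrMr// mul1r ler_nat.
Qed.

Lemma jac_quot_le K x i j : `|jac_quot K x i j| <= L.
Proof. by rewrite mxE; apply: dquot_bound; exact: lip_comp. Qed.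

Variables (k l K : nat) (c : grid n k) (p : 'rV[R]_n) (theta thr : R).
Hypothesis l2 : (2 <= l)%N.
Hypothesis theta0 : 0 < theta.
Hypothesis thr_theta : thr <= theta ^+ 2 / 4.
Hypothesis kK : 6 * L * dyadic k <= theta / 2 * dyadic K.
Hypothesis pc : forall j, (c j)%:R * dyadic k - dyadic k / 4 <= p 0 j
  <= (c j)%:R * dyadic k + 5 / 4 * dyadic k.
Hypothesis p01 : forall j, dyadic k <= p 0 j <= 1 - dyadic k.
Hypothesis low : forall d : grid n k, nearg d c -> 
  \forall N \near U, \forall m \near U,
  cube_sum m d (jac_osc K N) <= thr * ((2 ^ (m - k)) ^ n)%:R.

Lemma near_cube_dist d x : nearg d c -> in_cube d x -> `|x - p| <= 3 * dyadic k.
Proof.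
move=> /forallP dc dx; have h0 := @dyadic_gt0 R k.
apply: mx_norm_leP => [|r j]; first by rewrite mulr_ge0 ?dyadic_ge0.
rewrite !mxE ord1; have /andP[A B] := pc j; have /andP[C D] := dx j; have /andP[] := dc j.
rewrite -!(ler_nat R) -!natr1 in D *; move=> E F.
have E' : (d j)%:R * dyadic k <= ((c j)%:R + 1) * dyadic k :> R by rewrite ler_pM2r.
have F' : (c j)%:R * dyadic k <= ((d j)%:R + 1) * dyadic k :> R by rewrite ler_pM2r.
move: A B C D E' F'; rewrite !mulrDl !mul1r; move: (_ * dyadic k) (_ * dyadic k).
move: (dyadic k) h0 (x 0 j) (p 0 j) => h h0 a b u v A B C D E' F'.
by rewrite ler_norml; apply/andP; split; lra.
Qed.

(** The oscillation refers to the moving matrix [jac_quot K x]. Its level [K] is fixed and the cubes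
    are much smaller, so by [kK] it can be frozen at [p] up to [theta / 2]. The square of a sum is
    at most twice the sum of squares, whence the bound [theta ^+ 2 / 4] on [thr]. *)
Lemma low_entry i j (d : grid n k) : nearg d c -> 
  \forall N \near U, \forall m \near U,
  cube_sum m d (fun x => (dquot N i (fun y => g y 0 j) x - jac_quot K p i j) ^+ 2)
    <= theta ^+ 2 * ((2 ^ (m - k)) ^ n)%:R.
Proof.
have geU : \forall m \near U, (k <= m)%N by apply: ooU; exists k.
move=> dc; apply: filterS (low dc) => N; apply: filterS2 geU => m km H.
have pt x : in_cube d x -> (dquot N i (fun y => g y 0 j) x - jac_quot K p i j) ^+ 2 <=
    2 * jac_osc K N x + theta ^+ 2 / 2.
  move=> dx; have := dquot_lip (lip_comp j) K i x p.
  set a := dquot N _ _ _; have -> : jac_quot K p i j = dquot K i (fun y => g y 0 j) p by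
    rewrite mxE.
  set b := dquot K _ _ p; set b' := dquot K _ _ x => bb.
  have {}bb : `|b' - b| <= theta / 2.
    apply: le_trans bb _; rewrite mulrAC ler_pdivrMr ?dyadic_gt0//.
    apply: le_trans kK; rewrite [leRHS](_ : _ = 2 * L * (3 * dyadic k)); last by ring.
    by rewrite ler_wpM2l ?mulr_ge0//; exact: near_cube_dist dc dx.
  have osc : (a - b') ^+ 2 <= jac_osc K N x.
    rewrite /jac_osc (bigD1 i)//= (bigD1 j)//= !mxE -/a -/b' -addrA lerDl.
    by rewrite addr_ge0//; apply: sumr_ge0 => *; rewrite ?sumr_ge0// => *; exact: sqr_ge0.
  have : (b' - b) ^+ 2 <= (theta / 2) ^+ 2.
    by rewrite -[leLHS]real_normK ?num_real// lerXn2r// nnegrE ltW// divr_gt0.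
  move: osc; have := sqr_ge0 ((a - b') - (b' - b)); nra.
apply: (@le_trans _ _ (cube_sum m d (fun x => 2 * jac_osc K N x + theta ^+ 2 / 2))).
  apply: ler_sum => a /eqP ad; apply: pt; rewrite -ad; exact: gpoint_in_cube.
rewrite /cube_sum big_split/= -mulr_sumr sumr_const (card_cube d km) -[_ *+ _]mulr_natr.
rewrite /cube_sum in H; move: H; set s := \sum_(_ | _) _; set kap : R := _%:R => H.
have kap0 : 0 <= kap by rewrite ler0n.
have : thr * kap <= theta ^+ 2 / 4 * kap by rewrite ler_wpM2r.
by move: H; lra.
Qed.

Let om := (theta * ((3 ^ n * (2 ^ l) ^ n)%:R) + 4 * L * dyadic l) * dyadic k.

Lemma poincare_axis_signed i j y (t : R) : `|y - p| <= dyadic k / 4 ->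
  `|y + t *: evec i - p| <= dyadic k / 4 ->
  `|g (y + t *: evec i) 0 j - g y 0 j - t * jac_quot K p i j| <= om.
Proof.
move=> yp ytp; have Aij := jac_quot_le K p i j.
have P := poincare_axis UU ooU (lip_comp j) l2 theta0 Aij pc p01 (@low_entry i j).
have [t0|t0] := leP 0 t; first exact: P.
have := P (y + t *: evec i) (- t); rewrite scaleNr addrK oppr_ge0 => /(_ (ltW t0) ytp yp).
by rewrite -normrN; congr (_ <= _); congr `|_|; ring.
Qed.

(** The path from 0 to [v] changes one coordinate at a time. In the sup norm the truncations [tr s]
    are no longer than [v], so each of the [n] steps is covered by the estimate along an axis. *)
Lemma local_approx v : `|v| <= dyadic k / 4 ->
  `|g (p + v) - g p - v *m jac_quot K p| <= n%:R * om.
Proof.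
move=> vk; have h0 := @dyadic_gt0 R k.
pose tr (s : nat) : 'rV[R]_n := \row_(i < n) (if (i < s)%N then v 0 i else 0).
have trn s : `|tr s| <= dyadic k / 4.
  apply: mx_norm_leP => [|r i]; first by rewrite divr_ge0 ?dyadic_ge0.
  by rewrite mxE; case: ifP => _; rewrite ?normr0 ?divr_ge0 ?dyadic_ge0// (le_trans
    (mx_entry_le v 0 i)).
have trS s (sn : (s < n)%N) : tr s.+1 = tr s + v 0 (Ordinal sn) *: evec (Ordinal sn).
  apply/rowP => i; rewrite !mxE eqxx/= ltnS leq_eqVlt -val_eqE/=.
  have [is_|/=] := eqVneq (i : nat) s; last by rewrite mulr0 addr0.
  by rewrite is_ ltnn add0r mulr1; congr (v 0 _); exact/val_inj.
have tr0 : tr 0%N = 0 by apply/rowP => i; rewrite !mxE.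
have trE : tr n = v by apply/rowP => i; rewrite !mxE ltn_ord.
have step s j : (s <= n)%N ->
   `|g (p + tr s) 0 j - g p 0 j - (tr s *m jac_quot K p) 0 j| <= s%:R * om.
  elim: s => [_|s IH sn]; first by rewrite tr0 addr0 mul0mx !mxE subrr subr0 normr0 mul0r.
  have := IH (ltnW sn).
  have := @poincare_axis_signed (Ordinal sn) j (p + tr s) (v 0 (Ordinal sn)).
  have pK (x : 'rV[R]_n) : p + x - p = x by rewrite addrAC subrr add0r.
  rewrite -[p + tr s + _ *: _]addrA -(trS s sn) !pK => /(_ (trn _) (trn _)).
  have -> : (tr s.+1 *m jac_quot K p) 0 j = (tr s *m jac_quot K p) 0 j +
      v 0 (Ordinal sn) * jac_quot K p (Ordinal sn) j.
    by rewrite (trS s sn) mulmxDl mxE -scalemxAl -rowE !mxE.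
  move: (g (p + tr s.+1) 0 j) (g (p + tr s) 0 j) (g p 0 j) => a b e.
  move: (v 0 _ * jac_quot _ _ _ _) ((tr s *m _) 0 j) => f h.
  rewrite -natr1 mulrDl mul1r => h1 h2.
  have -> : a - e - (h + f) = (b - e - h) + (a - b - f) by ring.
  by apply: le_trans (ler_normD _ _) _; exact: lerD.
apply: mx_norm_leP => [|r j].
  by rewrite mulr_ge0// /om mulr_ge0 ?dyadic_ge0// addr_ge0 ?mulr_ge0 ?dyadic_ge0// ltW.
by rewrite ord1; have := step n j (leqnn n); rewrite trE !mxE.
Qed.

End LocalApprox.

(** * Distance to the nearest integer and thin periodic tubes *)

Section IntDist.
Context {R : realType}.
Implicit Types (s t r : R) (z : int).

(** This tent function of period 1 serves twice: to describe neighbourhoods modulo integer vectors,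
    and to fold space onto a cube of side 1/2. *)
Definition int_dist t : R :=
  Num.min (t - (Num.floor t)%:~R) (1 - (t - (Num.floor t)%:~R)).

Lemma int_dist_le t z : int_dist t <= `|t - z%:~R|.
Proof.
rewrite /int_dist ge_min; have [zf|] := leP z (Num.floor t).
  have : z%:~R <= (Num.floor t)%:~R :> R by rewrite ler_int.
  by have := ler_norm (t - z%:~R); move: (z%:~R) => u h1 h2; apply/orP; left; lra.
rewrite -lezD1 -(ler_int R) intrD => h; apply/orP; right.
by rewrite distrC; have := ler_norm (z%:~R - t); lra.
Qed.

Lemma int_dist_ex t : exists z, int_dist t = `|t - z%:~R|.
Proof.
have /andP[f1 f2] := floor_itv t; rewrite intrD in f2; rewrite /int_dist.
have [_|_] := leP (t - (Num.floor t)%:~R) (1 - (t - (Num.floor t)%:~R)).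
  by exists (Num.floor t); rewrite ger0_norm ?subr_ge0.
exists (Num.floor t + 1); rewrite intrD distrC ger0_norm ?subr_ge0 ?ltW//.
by rewrite opprB addrCA addrA.
Qed.

Lemma int_distD1 t : int_dist (t + 1) = int_dist t.
Proof.
apply/eqP; rewrite eq_le; apply/andP; split.
  have [z ->] := int_dist_ex t; apply: le_trans (int_dist_le _ (z + 1)) _.
  by rewrite intrD opprD addrACA subrr addr0.
have [z ->] := int_dist_ex (t + 1); apply: le_trans (int_dist_le _ (z - 1)) _.
by rewrite intrD mulrN1z opprD opprK addrA addrAC.
Qed.

Lemma int_dist_lip s t : `|int_dist s - int_dist t| <= `|s - t|.
Proof.
have aux u v : int_dist u - int_dist v <= `|u - v|.
  have [z ->] := int_dist_ex v; rewrite lerBlDr.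
  apply: le_trans (int_dist_le u z) _.
  by rewrite -[X in `|X|](subrKA v) ler_normD.
by rewrite ler_norml aux andbT lerNl opprB distrC aux.
Qed.

Lemma int_dist_id t : 0 <= t <= 2^-1 -> int_dist t = t.
Proof.
move=> /andP[t0 t1]; apply/eqP; rewrite eq_le; apply/andP; split.
  by apply: le_trans (int_dist_le _ 0) _; rewrite subr0 ger0_norm.
have [z ->] := int_dist_ex t; have [z0|z0] := leP z 0.
  by rewrite (le_trans _ (ler_norm _))// lerDl oppr_ge0 lerz0.
have : 1 <= z%:~R :> R by rewrite ler1z.
by move=> h; rewrite distrC (le_trans _ (ler_norm _))//; lra.
Qed.

Lemma int_dist_lt t r : - (3 / 4) <= t <= 3 / 4 -> r <= 4^-1 -> int_dist t < r -> `|t| < r.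
Proof.
move=> /andP[t1 t2] r4; have [z ->] := int_dist_ex t => tz.
suff z0 : z = 0 by rewrite z0 subr0 in tz.
have : `|z%:~R| < 1 :> R.
  by move: tz; rewrite !ltr_norml => /andP[? ?]; apply/andP; split; lra.
by rewrite -intr_norm ltrz1; lia.
Qed.

End IntDist.

Section TargetSet.
Context {R : realType} {n : nat}.
Variables (H : 'rV[R]_n -> R) (L : R) (i0 : 'I_n) (beta eta rho : R).
Hypothesis lipH : forall x y, `|H x - H y| <= L * `|x - y|.
Hypothesis perH : zperiodic H.
Hypothesis eta0 : 0 < eta.

Definition near_base (x : 'rV[R]_n) := forall j, int_dist (x 0 j - 4^-1) < rho.

Hypothesis base_quot : forall x, near_base x -> dquot 3 i0 H x <= beta.

(* Points of a thin tube around the segment of length [1/8] issued from the point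
   with coordinates [1/4], where the difference quotient is not too large. *)
Definition target K (x : 'rV[R]_n) :=
  (exists2 s : R, 0 <= s <= 8^-1 & near_base (x - s *: evec i0)) /\
  dquot K i0 H x <= beta + eta.

Lemma near_base_periodic : zperiodic (fun x => `[< near_base x >]).
Proof.
move=> i x; congr (`[< _ >]); apply/propext; split => b j; have := b j; rewrite !mxE eqxx/=.
  by case: eqP => _; rewrite ?addr0// addrAC int_distD1.
by case: eqP => _; rewrite ?addr0// addrAC int_distD1.
Qed.

(* [D_3 H] is the average of [D_K H] along the segment, so shifting the weight
   [psi] instead of [D_K H] bounds a weighted mean of [D_K H] by [beta]; the lower
   bound on the cardinal does not depend on [K]. *)
Lemma target_card k1 K m : (2 <= k1)%N -> dyadic k1 < rho -> (3 <= K)%N -> (K <= m)%N ->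
  (k1 <= m)%N ->
  eta / (L + beta + eta) * dyadic k1 ^+ n * ((2 ^ m) ^ n)%:R <=
  #|[pred a : grid n m | `[< target K (gpoint a) >]]|%:R.
Proof.
move=> k12 k1r K3 Km k1m.
pose psi x : R := if `[< near_base x >] then 1 else 0.
have psi_per : zperiodic psi by move=> i x; rewrite /psi near_base_periodic.
(* [eta - D = - L - beta] bounds [dquot K i0 H - beta] from below everywhere, while off the target
   set, over the shifted base, this difference exceeds [eta]. *)
pose D := L + beta + eta.
pose z0 : 'rV[R]_n := \row_j 4^-1.
have base0 : near_base z0.
  move=> j; rewrite mxE subrr int_dist_id; last by rewrite lexx invr_ge0 ler0n.
  exact: lt_trans (dyadic_gt0 k1) k1r.
have D0 : 0 < D.
  have := base_quot base0; have := dquot_bound lipH 3 i0 z0.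
  rewrite ler_norml /D; move: (dquot _ _ _ _) eta0 => d e0 /andP[d1 _] d2; lra.
pose chi x : R := if `[< target K x >] then 1 else 0.
pose s := (2 ^ (K - 3))%N.
have s0 : (0 < s)%N by rewrite expn_gt0.
pose X l := gsum m (fun x => psi x * (dquot K i0 H (x + (l%:R * dyadic K) *: evec i0) - beta)).
have X0 : \sum_(l < s) X l <= 0.
  have -> : \sum_(l < s) X l = s%:R * gsum m (fun x => psi x * (dquot 3 i0 H x - beta)).
    rewrite -gsumZ /X /gsum exchange_big/=; apply: eq_bigr => a _.
    rewrite -mulr_sumr mulrCA (dquot_line_avg _ _ _ K3) /line_avg -/s mulrBr mulrA.
    by rewrite mulfV ?pnatr_eq0 -?lt0n// mul1r sumrB sumr_const card_ord mulr_natl.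
  rewrite pmulr_rle0 ?ltr0n//; apply: sumr_le0 => a _; rewrite /psi.
  by case: asboolP => [/base_quot b|_]; rewrite ?mul0r// mul1r subr_le0.
have Xge (l : 'I_s) : eta * gsum m psi - D * gsum m chi <= X l.
  pose v : 'rV[R]_n := (l%:R * dyadic K) *: evec i0.
  have -> : X l = gsum m (fun x => psi (x - v) * (dquot K i0 H x - beta)).
    rewrite -[RHS](@gsum_shift _ _ m i0 l K)//; last first.
      move=> i x; rewrite (periodic_dquot _ _ perH); congr (_ * _).
      exact: (zperiodicT (- v) psi_per).
    by apply: eq_bigr => a _; rewrite -/v addrK.
  have -> : gsum m psi = gsum m (fun x => psi (x - v)).
    rewrite -[RHS](@gsum_shift _ _ m i0 l K)//; last exact: (zperiodicT (- v) psi_per).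
    by apply: eq_bigr => a _; rewrite -/v addrK.
  rewrite -mulNr -!gsumZ -gsumD; apply: ler_gsum => x; rewrite /psi /chi.
  have [b|_] := asboolP (near_base (x - v)); last first.
    rewrite mulr0 add0r mul0r mulNr oppr_le0.
    by case: asboolP => _; rewrite ?mulr0// mulr1 ltW.
  rewrite mulr1 mul1r; have := dquot_bound lipH K i0 x; rewrite ler_norml => /andP[dL _].
  case: asboolP => [_|nt]; first by rewrite /D; lra.
  have [dl|] := leP (dquot K i0 H x) (beta + eta); last by lra.
  case: nt; split => //; exists (l%:R * dyadic K) => //.
  rewrite mulr_ge0 ?dyadic_ge0//= (_ : 8^-1 = dyadic 3); last by rewrite /dyadic exprVn -natrX.
  by rewrite (dyadicE K3) ler_wpM2r ?dyadic_ge0// ler_nat ltnW.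
have le0 : eta * gsum m psi <= D * gsum m chi.
  rewrite -subr_le0 -(pmulr_rle0 _ (_ : 0 < s%:R)) ?ltr0n//.
  apply: le_trans X0; rewrite mulr_natl -[X in _ *+ X]card_ord -sumr_const.
  by apply: ler_sum => l _; exact: Xge.
have -> : #|[pred a : grid n m | `[< target K (gpoint a) >]]|%:R = gsum m chi.
  by rewrite -sum1_card natr_sum big_mkcond/=; apply: eq_bigr => a _; rewrite inE.
rewrite -mulrA mulrAC ler_pdivrMr//; rewrite [leRHS]mulrC; apply: le_trans le0.
rewrite ler_pM2l//.
(* The cube of side [dyadic k1] with lower corner at 1/4 lies in the base and contributes the factor
   [dyadic k1 ^+ n], whatever [K] is. *)
have lt4 : (2 ^ (k1 - 2) < 2 ^ k1)%N by rewrite ltn_exp2l//; lia.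
pose c1 : grid n k1 := [ffun=> Ordinal lt4].
have -> : dyadic k1 ^+ n * ((2 ^ m) ^ n)%:R = ((2 ^ (m - k1)) ^ n)%:R :> R.
  rewrite !natrX -exprMn -{1}(subnK k1m) exprD mulrCA [dyadic _ * _]mulrC.
  by rewrite -[2%:R ^+ k1]natrX dyadic_pow mulr1.
rewrite -(card_cube c1 k1m) -sum1_card natr_sum /gsum big_mkcond/=.
apply: ler_sum => a _; rewrite inE /psi; case: eqP => [ac|_]; last by case: asboolP.
case: asboolP => // -[] j; have := gpoint_in_cube (R := R) a k1m j.
rewrite ac ffunE/= -natr1 mulrDl mul1r.
have -> : (2 ^ (k1 - 2))%:R * dyadic k1 = 4^-1 :> R.
  by rewrite -(dyadicE k12) /dyadic exprVn -natrX.
move=> /andP[h1 h2]; apply: le_lt_trans k1r; apply: le_trans (int_dist_le _ 0) _.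
by rewrite subr0 ger0_norm; lra.
Qed.

End TargetSet.

(** * Quantitative Rademacher theorem for periodic maps *)

Lemma zperiodic_int {R : realType} n T (G : 'rV[R]_n -> T) (z : 'I_n -> int) x :
  zperiodic G -> G (x + \row_j (z j)%:~R) = G x.
Proof.
move=> pG; have nat1 i (k : nat) y : G (y + k%:R *: evec i) = G y.
  elim: k y => [|k IH] y; first by rewrite scale0r addr0.
  by rewrite -natr1 scalerDl scale1r addrA pG.
have int1 i (k : int) y : G (y + k%:~R *: evec i) = G y.
  case: k => k; first exact: nat1.
  by rewrite NegzE mulrNz scaleNr -[LHS](nat1 i k.+1) subrK.
rewrite [\row_j _]row_sum_delta; elim/big_ind: _ x => [x|a b IHa IHb x|i _ x].
- by rewrite addr0.
- by rewrite addrA IHb IHa.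
- by rewrite mxE int1.
Qed.

(** [l] comes first, to make the displacement error small, and then [theta], which has to beat
    [(2 ^ l) ^ n]. In the factor [8 * n%:R], [n] counts the coordinate steps and 8 compares the
    dyadic scale with the length of the increment. *)
Lemma choose_window {R : realType} (n : nat) (L e : R) : 0 <= L -> 0 < e ->
  exists l theta, [/\ (2 <= l)%N, 0 < theta &
    8 * n%:R * (theta * (3 ^ n * (2 ^ l) ^ n)%:R + 4 * L * dyadic l) <= e].
Proof.
move=> L0 e0; pose B := e / (16 * n%:R + 1).
have n0 : 0 <= n%:R :> R by [].
have B0 : 0 < B by rewrite divr_gt0//; lra.
have [l1 Hl] : exists l1, forall l, (l1 <= l)%N -> dyadic l <= B / (4 * L + 1).
  by apply: near_dyadic; rewrite divr_gt0//; lra.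
pose l := maxn 2 l1; have := Hl l (leq_maxr _ _).
rewrite ler_pdivlMr; last by lra.
move=> hl; set M : R := (3 ^ n * (2 ^ l) ^ n)%:R.
have M0 : 0 < M by rewrite ltr0n muln_gt0 !expn_gt0.
exists l, (B / M); split; [exact: leq_maxl|exact: divr_gt0|].
rewrite divfK ?gt_eqF//.
have d0 := @dyadic_ge0 R l.
apply: (@le_trans _ _ (8 * n%:R * (B + B))).
  by rewrite ler_wpM2l ?mulr_ge0// lerD2l; lra.
have -> : 8 * n%:R * (B + B) = B * (16 * n%:R) by ring.
have : B * (16 * n%:R + 1) = e by rewrite divfK// gt_eqF//; lra.
by lra.
Qed.

Section ApproxDiff.
Context {R : realType} {n q : nat}.
Implicit Types (x y p v : 'rV[R]_n).

(** The tolerance [e] is fixed and the matrix may depend on it, which is what the dyadic estimates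
    deliver. *)
Definition approx_diff (g : 'rV[R]_n -> 'rV[R]_q) p (e : R) (A : 'M[R]_(n, q)) :=
  exists2 d : R, 0 < d & forall v, `|v| <= d -> `|g (p + v) - g p - v *m A| <= e * `|v|.

Variables (g : 'rV[R]_n -> 'rV[R]_q) (L : R).
Hypothesis L0 : 0 <= L.
Hypothesis lipg : forall x y, `|g x - g y| <= L * `|x - y|.
Hypothesis perg : zperiodic g.
Variables (i0 : 'I_n) (u : 'cV[R]_q) (beta : R).

Let H x := (g x *m u) 0 0.
Let z0 : 'rV[R]_n := \row_j 4^-1.
Let LH := L * \sum_j `|u j 0|.

Let lipH x y : `|H x - H y| <= LH * `|x - y|.
Proof.
have -> : H x - H y = \sum_j (g x - g y) 0 j * u j 0.
  by rewrite /H !mxE -sumrB; apply: eq_bigr => j _; rewrite !mxE mulrBl.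
apply: le_trans (ler_norm_sum _ _ _) _; rewrite /LH mulrAC mulr_sumr; apply: ler_sum => j _.
by rewrite normrM ler_wpM2r// (le_trans (mx_entry_le _ _ _)).
Qed.

Let perH : zperiodic H.
Proof. by move=> i x; rewrite /H perg. Qed.

Let jac_H K x : (jac_quot g K x *m u) i0 0 = dquot K i0 H x.
Proof.
rewrite /H /dquot !mxE -sumrB mulr_suml; apply: eq_bigr => j _.
by rewrite !mxE /dquot; ring.
Qed.

Hypothesis quot_z0 : dquot 3 i0 H z0 < beta.
Variables (rho0 eps0 : R).
Hypothesis rho00 : 0 < rho0.
Hypothesis eps00 : 0 < eps0.

(** Stage [r] gives a point [x r] of the tube that is good for the first [r] tolerances down to
    scale [dyadic r]. A cluster point [p] inherits the approximation: at scale [dyadic k] it is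
    enough that some [x r] with [r] large lies within [dyadic k / 4] of [p], since the neighbours of
    its cube are controlled too. *)
Theorem approx_diff_point : exists p,
  [/\ exists2 s : R, 0 <= s <= 8^-1 & `|p - z0 - s *: evec i0| <= rho0,
      forall e : R, 0 < e -> exists A, approx_diff g p e A &
      exists2 A, approx_diff g p eps0 A & (A *m u) i0 0 <= beta].
Proof.
have [U [UU ooU]] := ultraFilterLemma (F := \oo) _.
have geU k : \forall m \near U, (k <= m)%N by apply: ooU; exists k.
(* One quarter of the gap is spent from [z0] to the base, one from the mean to the target set, one
   from [x r] to its cluster point [p]; one is spare. *)
pose b0 := dquot 3 i0 H z0; pose eta := (beta - b0) / 4; pose beta1 := b0 + eta.
have eta0 : 0 < eta by rewrite divr_gt0// subr_gt0.
have LH0 : 0 <= LH by rewrite mulr_ge0// sumr_ge0.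
pose rho1 := Num.min (rho0 / 2) (Num.min 32^-1 (eta / (16 * LH + 1))).
have rho10 : 0 < rho1.
  rewrite !lt_min; apply/and3P; split; [exact: divr_gt0|by rewrite invr_gt0|].
  by apply: divr_gt0 => //; lra.
have rho1a : rho1 <= rho0 / 2 by rewrite ge_min lexx.
have rho1b : rho1 <= 32^-1 by rewrite !ge_min lexx !orbT.
have rho1c : 16 * LH * rho1 <= eta.
  have : rho1 * (16 * LH + 1) <= eta.
    by rewrite -ler_pdivlMr ?ge_min ?lexx ?orbT//; lra.
  by lra.
have base_quot x : near_base rho1 x -> dquot 3 i0 H x <= beta1.
  move=> bx; have /choice[z zP] j : exists z : int, `|x 0 j - 4^-1 - z%:~R| < rho1.
    by have [z zE] := int_dist_ex (x 0 j - 4^-1); exists z; rewrite -zE.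
  pose x' := x - \row_j (z j)%:~R.
  have -> : dquot 3 i0 H x = dquot 3 i0 H x'.
    by rewrite -[RHS](zperiodic_int z)// ?subrK//; exact: periodic_dquot.
  have d : `|x' - z0| <= rho1.
    apply: mx_norm_leP => [|r j]; first exact: ltW.
    by rewrite !mxE ord1 addrAC ltW.
  have := dquot_lip lipH 3 i0 x' z0.
  have -> : 2 * LH / dyadic 3 = 16 * LH by rewrite /dyadic; field.
  have A : 16 * LH * `|x' - z0| <= 16 * LH * rho1.
    by apply: ler_wpM2l => //; apply: mulr_ge0.
  by rewrite -/b0 ler_norml /beta1 => /andP[_ ?]; lra.
have [k1' k1P] := near_dyadic (divr_gt0 rho10 (ltr0Sn R 1)).
pose k1 := maxn 2 k1'.
have k12 : (2 <= k1)%N by rewrite leq_maxl.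
have k1r : dyadic k1 < rho1 by have := k1P k1 (leq_maxr _ _); lra.
pose c0 := eta / (LH + beta1 + eta) * dyadic k1 ^+ n.
have c00 : 0 < c0.
  rewrite mulr_gt0 ?exprn_gt0 ?dyadic_gt0// divr_gt0//.
  have := dquot_bound lipH 3 i0 z0; rewrite -/b0 ler_norml => /andP[? _].
  by rewrite /beta1; lra.
pose ep j := eps0 / j.+1%:R.
have ep0 j : 0 < ep j by rewrite divr_gt0.
have /choice[l /choice[theta ltP]] j := choose_window n L0 (ep0 j).
pose thr j := theta j ^+ 2 / 4.
have thr0 j : 0 < thr j by have [_ ? _] := ltP j; rewrite divr_gt0// exprn_gt0.
(* With this choice the points excluded for tolerance [j] have proportion at most
   [c0 * dyadic j.+1], and the partial sums stay below [c0]. *)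
pose et j := thr j * (c0 * dyadic j.+1) / (3 ^ n)%:R.
have n30 : 0 < (3 ^ n)%:R :> R by rewrite ltr0n expn_gt0.
have et0 j : 0 < et j by rewrite divr_gt0// mulr_gt0// mulr_gt0// dyadic_gt0.
have /choice[K0 K0P] j := jac_osc_small UU ooU lipg perg (et0 j).
pose K j := maxn 3 (K0 j).
have Weta j : \forall N \near U, \forall m \near U,
    gsum m (jac_osc g (K j) N) <= et j * ((2 ^ m) ^ n)%:R.
  by apply: filterS (geU (K j)) => N KN; apply: K0P => //; rewrite leq_maxr.
have Sc0 : \forall m \near U, c0 * ((2 ^ m) ^ n)%:R <=
    #|[pred a : grid n m | `[< target H i0 beta1 eta rho1 (K 0%N) (gpoint a) >]]|%:R.
  apply: filterS2 (geU (K 0%N)) (geU k1) => m Km k1m.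
  by apply: (target_card lipH perH eta0 base_quot) => //; rewrite leq_maxl.
have ltc0 r : \sum_(j < r) ((3 ^ n)%:R * et j / thr j) < c0.
  have -> : \sum_(j < r) ((3 ^ n)%:R * et j / thr j) = c0 * (1 - dyadic r).
    elim: r => [|r IH]; first by rewrite big_ord0 /dyadic expr0 subrr mulr0.
    rewrite big_ord_recr/= IH (dyadicS r) /et; field.
    by rewrite !gt_eqF ?thr0// -natrX.
  by rewrite gtr_pMr// gtrDl oppr_lt0 dyadic_gt0.
have /choice[x xP] : forall r, exists y, target H i0 beta1 eta rho1 (K 0%N) y /\
    forall k, (k <= r)%N -> exists2 c : grid n k, in_cube c y &
    forall d : grid n k, nearg d c -> forall j, (j < r)%N ->
    \forall N \near U, \forall m \near U,
      cube_sum m d (jac_osc g (K j) N) <= thr j * ((2 ^ (m - k)) ^ n)%:R.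
  move=> r; have [y Sy yP] := select_points UU ooU
    (fun j N y => jac_osc_ge0 g (K j) N y) thr0 Weta Sc0 ltc0 r.
  by exists y.
have x01 r j : 0 <= x r 0 j <= 1.
  have [_ /(_ 0%N (leq0n _)) [c /(_ j) + _]] := xP r.
  have -> : c j = 0%N :> nat by case: (c j) => -[].
  by rewrite /dyadic expr0 !mulr1.
have box_compact : compact [set v : 'rV[R]_n | forall i, v ord0 i \in `[0, 1]].
  apply: (@rV_compact R n (fun=> `[(0 : R), 1]%classic)) => _; exact: segment_compact.
have [|p [_ clp]] := box_compact (x @ \oo) (fmap_proper_filter _ _).
  by exists 0%N => // r _ i /=; rewrite in_itv/= x01.
have near_p d r0 : 0 < d -> exists2 r, (r0 <= r)%N & `|x r - p| <= d.
  move=> d0; have [|_ [[r r0r <-] pr]] := clp [set x r | r in [set r | (r0 <= r)%N]]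
    (ball p d) _ (nbhsx_ballx p d d0).
    by exists r0 => // r /= r0r; exists r.
  by exists r => //; move: pr; rewrite -ball_normE/= distrC => /ltW.
pose d1 := Num.min (rho0 / 2) 32^-1.
have d10 : 0 < d1 by rewrite lt_min divr_gt0//= invr_gt0.
have [s s8 ps] : exists2 s : R, 0 <= s <= 8^-1 & `|p - z0 - s *: evec i0| <= rho1 + d1.
  have [r _ xr] := near_p _ 0%N d10; have [[[s s8 bs] _] _] := xP r.
  exists s => //; rewrite [rho1 + _]addrC.
  have -> : p - z0 - s *: evec i0 = (p - x r) + (x r - z0 - s *: evec i0).
    by rewrite !addrA subrK.
  apply: le_trans (ler_normD _ _) _; rewrite distrC lerD//; apply: mx_norm_leP => [|r'
    j]; first exact: ltW.
  have := bs j; rewrite !mxE ord1 eqxx/= [_ - 4^-1]addrAC => dj; apply: ltW.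
  apply: int_dist_lt dj; last by lra.
  have /andP[? ?] := x01 r j; have /andP[? ?] := s8.
  by case: eqP => _; rewrite ?mulr0 ?mulr1; apply/andP; split; lra.
have p01 k j : (3 <= k)%N -> dyadic k <= p 0 j <= 1 - dyadic k.
  move=> k3; have := mx_entry_le (p - z0 - s *: evec i0) 0 j => /le_trans/(_ ps).
  have d132 : d1 <= 32^-1 by rewrite ge_min lexx orbT.
  have h8 : dyadic k <= 8^-1 :> R.
    by apply: le_trans (dyadic_le k3) _; rewrite /dyadic; lra.
  have /andP[s0 s8'] := s8; rewrite !mxE eqxx/= ler_norml.
  by case: eqP => _; rewrite ?mulr0 ?mulr1 => /andP[? ?]; apply/andP; split; lra.
have stage j : approx_diff g p (ep j) (jac_quot g (K j) p).
  have [l2 th0 win] := ltP j.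
  have [k0' k0P] : exists k0, forall k, (k0 <= k)%N ->
      dyadic k <= theta j / 2 * dyadic (K j) / (6 * L + 1).
    apply: near_dyadic; rewrite divr_gt0 ?mulr_gt0 ?dyadic_gt0//.
    by have := L0; lra.
  pose k0 := maxn 3 k0'.
  exists (dyadic k0 / 4) => [|v vk0]; first by rewrite divr_gt0 ?dyadic_gt0.
  have [->|vN0] := eqVneq v 0; first by rewrite addr0 mul0mx subrr subr0 !normr0 mulr0.
  have v0 : 0 < `|v| by rewrite normr_gt0.
  (* The scale is matched to [v]: minimality gives [dyadic k.+1 / 4 < |v| <= dyadic k / 4], so an
     error proportional to [dyadic k] is one proportional to [|v|], with factor 8. *)
  have ex : exists k, dyadic k / 4 < `|v|.
    have [k kP] := near_dyadic v0; exists k; have := kP k (leqnn _).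
    by have := @dyadic_gt0 R k; lra.
  case: (ex_minnP ex) => -[|k] kv kmin.
    have := dyadic_le1 (R := R) k0; move: kv vk0; rewrite /(dyadic 0) expr0; lra.
  have k0k : (k0 <= k)%N.
    rewrite leqNgt; apply/negP => kk0; have := dyadic_le (R := R) kk0; lra.
  have vk : `|v| <= dyadic k / 4.
    by rewrite leNgt; apply/negP => /kmin; rewrite ltnn.
  have k3 : (3 <= k)%N by apply: leq_trans k0k; rewrite leq_maxl.
  have h0 := @dyadic_gt0 R k.
  have [r rk xr] := near_p (dyadic k / 4) (maxn k j.+1) (divr_gt0 h0 (ltr0Sn _ 3)).
  move: rk; rewrite geq_max => /andP[kr jr].
  have [_ /(_ k kr)[c cx clow]] := xP r.
  have kK : 6 * L * dyadic k <= theta j / 2 * dyadic (K j).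
    have := k0P k (leq_trans (leq_maxr _ _) k0k); rewrite ler_pdivlMr; first by lra.
    by have := L0; lra.
  have pc i : (c i)%:R * dyadic k - dyadic k / 4 <= p 0 i <= (c i)%:R * dyadic k + 5 / 4
    * dyadic k.
    have /andP[] := cx i; rewrite -natr1 mulrDl mul1r => A B.
    have := le_trans (mx_entry_le (x r - p) 0 i) xr; rewrite !mxE ler_norml => /andP[C D].
    by apply/andP; split; lra.
  have := local_approx UU ooU L0 lipg l2 th0 (lexx (thr j)) kK pc (fun i => p01 k i k3)
    (fun d dc => clow d dc j jr) vk.
  move=> /le_trans; apply; rewrite mulrA.
  have hv : dyadic k <= 8 * `|v| by rewrite (dyadicS k); lra.
  apply: (@le_trans _ _ (n%:R * (theta j * (3 ^ n * (2 ^ l j) ^ n)%:R + 4 * L * dyadic (l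
    j)) * (8 * `|v|))).
    apply: ler_wpM2l => //; rewrite mulr_ge0// addr_ge0// mulr_ge0 ?dyadic_ge0
      ?mulr_ge0//; exact: ltW.
  move: win; set Q := theta j * _ + _ => win.
  have -> : n%:R * Q * (8 * `|v|) = 8 * n%:R * Q * `|v| by ring.
  by rewrite ler_pM2r.
exists p; split.
- exists s => //; apply: le_trans ps _.
  have : d1 <= rho0 / 2 by rewrite ge_min lexx.
  by lra.
- move=> e e0; pose j := Num.trunc (eps0 / e).
  exists (jac_quot g (K j) p); have [d d0 dP] := stage j; exists d => // v /dP/le_trans; apply.
  rewrite ler_wpM2r// ler_pdivrMr// mulrC -ler_pdivrMr// ltW//; exact: truncnS_gt.
- exists (jac_quot g (K 0%N) p).
    by have := stage 0%N; rewrite /ep divr1.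
  rewrite jac_H; pose dd := eta * dyadic (K 0%N) / (2 * LH + 1).
  have dd0 : 0 < dd.
    by apply: divr_gt0; [apply: mulr_gt0 => //; exact: dyadic_gt0|lra].
  have [r _ xr] := near_p _ 0%N dd0; have [[_ tr] _] := xP r.
  have := dquot_lip lipH (K 0%N) i0 (x r) p; rewrite ler_norml => /andP[+ _].
  have : 2 * LH / dyadic (K 0%N) * `|x r - p| <= eta.
    rewrite mulrAC ler_pdivrMr ?dyadic_gt0//.
    apply: (@le_trans _ _ (2 * LH * dd)); first by apply: ler_wpM2l => //; apply: mulr_ge0.
    have : dd * (2 * LH + 1) = eta * dyadic (K 0%N) by rewrite divfK// gt_eqF//; lra.
    by lra.
  move: tr; rewrite /beta1; have : eta * 4 = beta - b0 by rewrite divfK// pnatr_eq0.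
  by lra.
Qed.

End ApproxDiff.

Lemma mulmx_norm_le {R : realType} (n q : nat) (v : 'rV[R]_n) (A : 'M[R]_(n, q)) :
  `|v *m A| <= n%:R * `|A| * `|v|.
Proof.
apply: mx_norm_leP => [|i j]; first by rewrite !mulr_ge0.
rewrite mxE; apply: le_trans (ler_norm_sum _ _ _) _.
apply: (@le_trans _ _ (\sum_(k < n) (`|A| * `|v|))); last first.
  by rewrite sumr_const card_ord -mulrA mulr_natl.
by apply: ler_sum => k _; rewrite normrM mulrC ler_pM ?mx_entry_le.
Qed.

(** * Differentiability and the mean value inequality *)

Section Remainder.
Context {R : realType} {V W : normedModType R}.

Lemma differentiable_of_remainder (f : V -> W) (df : {linear V -> W}) (x : V) :
  continuous df ->
  (forall e : R, 0 < e -> exists2 d : R, 0 < d &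
     forall v, `|v| <= d -> `|f (x + v) - f x - df v| <= e * `|v|) ->
  differentiable f x.
Proof.
move=> dfc H; have lo : f \o shift x = cst (f x) + df +o_ 0 id.
  apply/eqaddoP => e e0; have [d d0 dP] := H e e0.
  apply/nbhs_ballP; exists d => // v; rewrite -ball_normE/= sub0r normrN => /ltW/dP.
  by rewrite [x + v]addrC -[(_ - _) v]/(f (v + x) - (f x + df v)) opprD addrA.
by apply/diff_locallyP; rewrite (diff_unique dfc lo).
Qed.

Lemma differentiable_remainder (f : V -> W) (x : V) : differentiable f x ->
  forall e : R, 0 < e -> exists2 d : R, 0 < d &
     forall v, `|v| <= d -> `|f (x + v) - f x - 'd f x v| <= e * `|v|.
Proof.
move=> /diff_locallyP[_ /eqaddoP h] e e0; have /nbhs_ballP[d /= d0 dP] := h e e0.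
exists (d / 2) => [|v vd]; first by rewrite divr_gt0.
have := dP v; rewrite -ball_normE/= sub0r normrN.
rewrite -[(_ - _) v]/(f (v + x) - (f x + 'd f x v)) opprD addrA [v + x]addrC; apply.
by apply: le_lt_trans vd _; rewrite gtr_pMr// invf_lt1// ltr1n.
Qed.

End Remainder.

Section DiffApprox.
Context {R : realType} {n q : nat}.
Implicit Types (f : 'rV[R]_n -> 'rV[R]_q) (p v : 'rV[R]_n) (A B : 'M[R]_(n, q)).

(** Both approximations hold for a small multiple of [v], and the resulting estimate is homogeneous,
    so [v] is arbitrary. *)
Lemma approx_diff_dist f p e e' A B : approx_diff f p e A -> approx_diff f p e' B ->
  forall v, `|v *m A - v *m B| <= (e + e') * `|v|.
Proof.
move=> [d d0 dA] [d' d0' dB] v; have [->|vN0] := eqVneq v 0.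
  by rewrite !mul0mx subrr !normr0 mulr0.
have v0 : 0 < `|v| by rewrite normr_gt0.
pose c := Num.min d d' / `|v|.
have c0 : 0 < c by rewrite divr_gt0// lt_min d0.
have cv : `|c *: v| = Num.min d d'.
  by rewrite normrZ gtr0_norm// divfK// gt_eqF.
have := dA (c *: v); have := dB (c *: v); rewrite cv !ge_min !lexx orbT => /(_ isT) hB
  /(_ isT) hA.
rewrite -(ler_pM2l c0) -[X in X * _ <= _](gtr0_norm c0) -normrZ scalerBr !scalemxAl.
rewrite mulrCA -[X in _ * (X * _)](gtr0_norm c0) -normrZ mulrDl cv.
set a := f (p + _) - f p in hA hB.
have -> : (c *: v) *m A - (c *: v) *m B = (a - (c *: v) *m B) - (a - (c *: v) *m A).
  by rewrite opprB [RHS]addrC addrA subrK.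
by apply: le_trans (ler_normB _ _) _; rewrite addrC lerD.
Qed.

Lemma approx_diff_near f p e A B : approx_diff f p e A ->
  approx_diff f p (e + n%:R * `|A - B|) B.
Proof.
move=> [d d0 dA]; exists d => // v /dA h; rewrite mulrDl.
have -> : f (p + v) - f p - v *m B = (f (p + v) - f p - v *m A) + v *m (A - B).
  by rewrite mulmxBr addrA subrK.
apply: le_trans (ler_normD _ _) _; rewrite lerD//; exact: mulmx_norm_le.
Qed.

Lemma approx_diff_differentiable f p A : (forall e : R, 0 < e -> approx_diff f p e A) ->
  differentiable f p.
Proof.
move=> H; pose df : {linear 'rV[R]_n -> 'rV[R]_q} := mulmxr A.
have dfc : continuous df.
  apply: bounded_linear_continuous; apply/linear_boundedP.
  exists (n%:R * `|A|); split; first by rewrite num_real.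
  move=> r nr v /=; apply: le_trans (mulmx_norm_le _ _) _.
  by rewrite ler_wpM2r// ltW.
apply: (differentiable_of_remainder dfc) => e e0; have [d d0 dP] := H e e0.
by exists d.
Qed.

Lemma differentiable_approx f p e : 0 < e -> differentiable f p -> approx_diff f p e ('J f p).
Proof.
move=> e0 /differentiable_remainder/(_ e e0)[d d0 dP]; exists d => // v /dP.
by rewrite /jacobian mul_rV_lin1.
Qed.

(** Matrices for different tolerances are close to each other by [approx_diff_dist], hence bounded.
    Their limit along an ultrafilter is one matrix that works for every tolerance. *)
Lemma differentiable_of_approx f p : (forall e : R, 0 < e -> exists A, approx_diff f p e A) ->
  differentiable f p.
Proof.
move=> H.
have /choice[A AP] (k : nat) : exists A, approx_diff f p (k.+1%:R^-1) A.
  by apply: H; rewrite invr_gt0.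
have [U [UU ooU]] := ultraFilterLemma (F := \oo) _.
have bnd k i j : `|A k i j - A 0%N i j| <= 2.
  have := approx_diff_dist (AP k) (AP 0%N) (evec i).
  rewrite -!rowE -linearB/= -[evec i]scale1r norm_evec normr1 mulr1 => h.
  have := mx_entry_le (row i (A k - A 0%N)) 0 j; rewrite !mxE => /le_trans/(_
    h)/le_trans; apply.
  by rewrite invr1 -[2]/(1 + 1) lerD2r invf_le1// ler1n.
have /choice[B /= BP] (ij : 'I_n * 'I_q) : exists l : R,
    forall e, 0 < e -> \forall k \near U, `|A k ij.1 ij.2 - l| <= e.
  apply: (@ultra_bounded_limit _ _ _ (A 0%N ij.1 ij.2 - 2) (A 0%N ij.1 ij.2 + 2)) => //.
  by apply: nearW => k; have := bnd k ij.1 ij.2; rewrite ler_norml => /andP[? ?];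
    apply/andP; split; lra.
apply: (@approx_diff_differentiable _ _ (\matrix_(i, j) B (i, j))) => e e0.
pose e' : R := e / 2 / n.+1%:R.
have e'0 : 0 < e' by rewrite !divr_gt0.
have : \forall k \near U, forall ij : 'I_n * 'I_q, `|A k ij.1 ij.2 - B ij| <= e'.
  by apply: filter_forall => ij; exact: BP.
have [k0 k0P] : exists k0 : nat, forall k, (k0 <= k)%N -> k.+1%:R^-1 <= e / 2.
  exists (Num.trunc (2 / e)) => k kk; rewrite -[leRHS]invrK lef_pV2 ?posrE ?invr_gt0
    ?divr_gt0//.
  rewrite invf_div; apply: ltW; apply: lt_le_trans (truncnS_gt _) _; by rewrite ler_nat.
have geU : \forall m \near U, (k0 <= m)%N by apply: ooU; exists k0.
move=> /(filterI geU)/filter_ex[k [/k0P kk kB]].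
have [d d0 dP] := approx_diff_near (\matrix_(i, j) B (i, j)) (AP k).
exists d => // v /dP/le_trans; apply; rewrite ler_wpM2r//.
have AB : `|A k - \matrix_(i, j) B (i, j)| <= e'.
  by apply: mx_norm_leP => [|i j]; [exact: ltW|rewrite !mxE; exact: (kB (i, j))].
have ne : n.+1%:R * e' = e / 2 by rewrite mulrC divfK.
rewrite [leRHS]splitr lerD// -ne; apply: le_trans (ler_wpM2l (ler0n R n) AB) _.
by rewrite ler_pM2r// ler_nat.
Qed.

End DiffApprox.

(** * Folding and the mean value inequality *)

Section Fold.
Context {R : realType} {n : nat}.

(* [g \o fold_row] is periodic and coincides with [g] on [[0, 1/2]^n]. *)
Definition fold_row (z : 'rV[R]_n) : 'rV[R]_n := \row_j int_dist (z 0 j).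

Lemma fold_row_periodic : zperiodic fold_row.
Proof.
move=> i z; apply/rowP => j; rewrite !mxE eqxx/=.
by case: eqP => _; rewrite ?addr0// int_distD1.
Qed.

Lemma fold_row_lip z z' : `|fold_row z - fold_row z'| <= `|z - z'|.
Proof.
apply: mx_norm_leP => // i j; rewrite !mxE; apply: le_trans (int_dist_lip _ _) _.
by have := mx_entry_le (z - z') 0 j; rewrite !mxE.
Qed.

Lemma fold_row_id (z : 'rV[R]_n) : (forall j, 0 <= z 0 j <= 2^-1) -> fold_row z = z.
Proof. by move=> h; apply/rowP => j; rewrite mxE int_dist_id. Qed.

(** [T] is the identity plus a rank one matrix that replaces the row of index [i0] by [v]; [S] is
    the Sherman-Morrison inverse, defined because [v 0 i0] is nonzero. *)
Lemma line_frame (v : 'rV[R]_n) : v != 0 ->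
  exists (i0 : 'I_n) (T S : 'M[R]_n), evec i0 *m T = v /\ S *m T = 1%:M.
Proof.
move=> vN0; have [i0 vi0] : exists i0, v 0 i0 != 0.
  apply: contrapT => /forallNP no; case/eqP: vN0; apply/rowP => i; rewrite mxE.
  by have /negP := no i; rewrite negbK => /eqP.
pose c := v 0 i0; pose w := v - evec i0; pose D : 'cV[R]_n := delta_mx i0 0.
have wD : w *m D = (c - 1)%:M.
  apply/matrixP => i j; rewrite !ord1 mulmxBl mul_delta_mx !mxE eqxx mulr1n /c.
  congr (_ - _); rewrite (bigD1 i0)//= !mxE !eqxx mulr1 big1 ?addr0// => k ki.
  by rewrite mxE (negbTE ki)/= mulr0.
exists i0, (1%:M + D *m w), (1%:M - c^-1 *: (D *m w)); split.
  rewrite mulmxDr mulmx1 mulmxA mul_delta_mx /w [X in _ + X](_ : _ = v - evec i0) ?subrKC//.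
  rewrite -[RHS]mul1mx; congr (_ *m _); apply/matrixP => i j.
  by rewrite !ord1 !mxE !eqxx.
rewrite mulmxDr mulmx1 mulmxBl mul1mx -scalemxAl mulmxA -(mulmxA D) wD mul_mx_scalar.
rewrite -scalemxAl scalerA.
have -> : c^-1 * (c - 1) = 1 - c^-1 by rewrite mulrBr mulVf// mulr1.
by rewrite scalerBl scale1r subKr subrK.
Qed.

End Fold.

Section MeanValue.
Context {R : realType} {n q : nat}.
Variables (f : 'rV[R]_n -> 'rV[R]_q) (L : R).
Hypothesis L0 : 0 <= L.
Hypothesis lipf : forall x y, `|f x - f y| <= L * `|x - y|.

(** [aff] maps the axis segment of length 1/8 issued from [z0] onto the segment from [x] to [x + v],
    so the increment of [f] becomes a quotient at level 3. The coordinates of that segment lie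
    between 1/4 and 3/8, well inside the cube on which folding is the identity. *)
Theorem mean_value_differentiable (x v : 'rV[R]_n) (u : 'cV[R]_q) (alpha r : R) :
  v != 0 -> 0 < r -> ((f (x + v) - f x) *m u) 0 0 < alpha ->
  exists p t, [/\ 0 <= t <= 1, `|p - (x + t *: v)| <= r, differentiable f p &
    (v *m 'J f p *m u) 0 0 < alpha].
Proof.
move=> vN0 r0 fa; have [i0 [T [S [eT ST]]]] := line_frame vN0.
pose z0 : 'rV[R]_n := \row_j 4^-1.
pose aff (z : 'rV[R]_n) := x + (8 *: (z - z0)) *m T.
pose g z := f (aff (fold_row z)).
have aff_lip z z' : `|aff z - aff z'| <= 8 * n%:R * `|T| * `|z - z'|.
  have -> : aff z - aff z' = (8 *: (z - z')) *m T.
    by rewrite /aff opprD addrACA subrr add0r -mulmxBl -scalerBr opprB addrA subrK.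
  apply: le_trans (mulmx_norm_le _ _) _; rewrite normrZ (ger0_norm (_ : 0 <= 8))//.
  by rewrite le_eqVlt; apply/orP; left; apply/eqP; ring.
pose Lg := L * (8 * n%:R * `|T|).
have Lg0 : 0 <= Lg by rewrite !mulr_ge0.
have lipg z z' : `|g z - g z'| <= Lg * `|z - z'|.
  apply: le_trans (lipf _ _) _; rewrite /Lg -mulrA ler_wpM2l//.
  apply: le_trans (aff_lip _ _) _; rewrite ler_wpM2l ?mulr_ge0//; exact: fold_row_lip.
have perg : zperiodic g by move=> i z; rewrite /g fold_row_periodic.
have d8 : dyadic 3 = 8^-1 :> R by rewrite /dyadic exprVn -natrX.
have affz0 : aff z0 = x by rewrite /aff subrr scaler0 mul0mx addr0.
have quot_z0 : dquot 3 i0 (fun z => (g z *m u) 0 0) z0 = 8 * ((f (x + v) - f x) *m u) 0 0.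
  rewrite /dquot d8 invrK mulrC /g !fold_row_id; last 2 first.
  - by move=> j; rewrite mxE; apply/andP; split; lra.
  - move=> j; rewrite !mxE eqxx/=.
    by case: eqP => _; rewrite ?mulr0 ?mulr1; apply/andP; split; lra.
  have -> : aff (z0 + 8^-1 *: evec i0) = x + v.
    rewrite /aff addrAC subrr add0r scalerA mulfV ?scale1r ?eT//.
  by rewrite affz0 mulmxBl; congr (8 * _); rewrite [RHS]mxE [X in _ = _ + X]mxE.
pose a0 := ((f (x + v) - f x) *m u) 0 0.
pose al := (a0 + alpha) / 2.
have quot_lt : dquot 3 i0 (fun z => (g z *m u) 0 0) z0 < 8 * al.
  rewrite quot_z0 -/a0 ltr_pM2l// /al ltr_pdivlMr//; move: fa; rewrite -/a0; lra.
pose C := n%:R * `|S| / 8.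
have C0 : 0 <= C by rewrite divr_ge0// mulr_ge0.
pose su := \sum_j `|u j 0|.
have su0 : 0 <= su by apply: sumr_ge0.
(* In [eps0], and in [e1] below, half of the gap [alpha - al] is divided by the final error factor
   plus 1; this 1 makes the last inequality strict. *)
pose eps0 := (alpha - al) / (2 * (C * `|v| * su + 1)).
have den0 : 0 < C * `|v| * su + 1 by rewrite ltr_wpDl// !mulr_ge0.
have al_lt : al < alpha by rewrite /al ltr_pdivrMr//; move: fa; rewrite -/a0; lra.
have eps00 : 0 < eps0 by rewrite divr_gt0 ?subr_gt0// mulr_gt0.
pose rho0 := Num.min 16^-1 (r / (8 * n%:R * `|T| + 1)).
have rho00 : 0 < rho0.
  rewrite lt_min invr_gt0 ltr0n/= divr_gt0// ltr_wpDl// !mulr_ge0//.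
have [p [[s s8 ps] H1 [A0 H2 H3]]] := approx_diff_point Lg0 lipg perg quot_lt rho00 eps00.
have p_in j : 8^-1 <= p 0 j <= 2^-1 - 16^-1.
  have := le_trans (mx_entry_le (p - z0 - s *: evec i0) 0 j) ps.
  have : rho0 <= 16^-1 by rewrite ge_min lexx.
  have /andP[s1 s2] := s8; rewrite !mxE eqxx/= ler_norml => rr.
  by case: eqP => _; rewrite ?mulr0 ?mulr1 => /andP[? ?]; apply/andP; split; lra.
have foldp h : `|h| <= 16^-1 -> fold_row (p + h) = p + h.
  move=> hh; apply: fold_row_id => j; have := le_trans (mx_entry_le h 0 j) hh.
  rewrite mxE ler_norml; have /andP[? ?] := p_in j => /andP[? ?]; apply/andP; split; lra.
pose P := aff p.
(* An increment [h] of [f] at [P] corresponds to the increment [8^-1 *: (h *m S)] of [g] at [p],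
   whose norm is at most [C] times that of [h]. *)
have transfer e A : 0 <= e -> approx_diff g p e A -> approx_diff f P (e * C) (8^-1 *: (S
  *m A)).
  move=> e0 [d d0 dP]; pose d' := Num.min d 16^-1 / (C + 1).
  have C1 : 0 < C + 1 by lra.
  have d'0 : 0 < d' by rewrite divr_gt0// lt_min d0 invr_gt0 ltr0n.
  exists d' => // h hd; pose h' := 8^-1 *: (h *m S).
  have h'C : `|h'| <= C * `|h|.
    rewrite normrZ ger0_norm ?invr_ge0//; apply: (@le_trans _ _ (8^-1 * (n%:R * `|S| * `|h|))).
      by rewrite ler_wpM2l ?invr_ge0//; exact: mulmx_norm_le.
    by rewrite le_eqVlt; apply/orP; left; apply/eqP; rewrite /C; ring.
  have h'd : `|h'| <= Num.min d 16^-1.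
    apply: le_trans h'C _; rewrite ler_pdivlMr// in hd; apply: le_trans hd.
    by rewrite [leRHS]mulrC ler_wpM2r//; lra.
  move: h'd; rewrite le_min => /andP[h'd h'16].
  have gE : g (p + h') = f (P + h).
    rewrite /g foldp//; congr f; rewrite /P /aff -[RHS]addrA; congr (_ + _).
    rewrite -[in RHS](mulmx1 h) -ST mulmxA -mulmxDl; congr (_ *m _).
    by rewrite addrAC [LHS]scalerDr scalerA mulfV// scale1r.
  have gE0 : g p = f P by rewrite /g -[p]addr0 foldp ?addr0// normr0 invr_ge0.
  have := dP h' h'd; rewrite gE gE0.
  have -> : h' *m A = h *m (8^-1 *: (S *m A)) by rewrite -scalemxAr -scalemxAl mulmxA.
  move=> /le_trans; apply; rewrite -mulrA.
  exact: ler_wpM2l.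
have dfP : differentiable f P.
  apply: differentiable_of_approx => e e0.
  have eC0 : 0 < e / (C + 1) by apply: divr_gt0 => //; lra.
  have [A /(transfer _ _ (ltW eC0)) AP] := H1 _ eC0.
  exists (8^-1 *: (S *m A)); have [d d0 dP] := AP; exists d => // h /dP/le_trans; apply.
  rewrite ler_wpM2r// mulrAC ler_pdivrMr; last by lra.
  by rewrite ler_wpM2l ?ltW//; lra.
exists P, (8 * s); split => //.
- by have /andP[? ?] := s8; apply/andP; split; lra.
- have -> : P - (x + (8 * s) *: v) = (8 *: (p - z0 - s *: evec i0)) *m T.
    rewrite /P /aff opprD addrACA subrr add0r -eT scalemxAl -mulmxBl.
    by congr (_ *m _); rewrite [RHS]scalerBr scalerA.
  apply: le_trans (mulmx_norm_le _ _) _; rewrite normrZ (ger0_norm (_ : 0 <= 8))//.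
  apply: (@le_trans _ _ (n%:R * `|T| * (8 * rho0))).
    by rewrite !ler_wpM2l// mulr_ge0.
  have : rho0 <= r / (8 * n%:R * `|T| + 1) by rewrite ge_min lexx orbT.
  rewrite ler_pdivlMr; last by rewrite ltr_wpDl// !mulr_ge0.
  by lra.
- pose e1 := (alpha - al) / (2 * (`|v| * su + 1)).
  have vsu0 : 0 <= `|v| * su by rewrite mulr_ge0.
  have e10 : 0 < e1 by rewrite divr_gt0 ?subr_gt0// mulr_gt0//; lra.
  have := approx_diff_dist (differentiable_approx e10 dfP) (transfer _ _ (ltW eps00) H2) v.
  set B := 8^-1 *: (S *m A0) => dist.
  have vB : (v *m B *m u) 0 0 <= al.
    have vS : v *m S = evec i0 by rewrite -eT -mulmxA (mulmx1C ST) mulmx1.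
    rewrite /B -scalemxAr -scalemxAl mxE mulmxA vS -mulmxA -rowE mxE.
    by rewrite ler_pdivrMl.
  have : ((v *m 'J f P - v *m B) *m u) 0 0 <= `|v *m 'J f P - v *m B| * su.
    rewrite mxE /su mulr_sumr; apply: ler_sum => j _; apply: le_trans (ler_norm _) _.
    by rewrite normrM ler_wpM2r// mx_entry_le.
  rewrite mulmxBl mxE [X in _ + X]mxE => le1.
  have {le1} : (v *m 'J f P *m u) 0 0 - (v *m B *m u) 0 0 <= (e1 + eps0 * C) * `|v| * su.
    by apply: le_trans le1 _; rewrite ler_wpM2r.
  have e1E : e1 * (`|v| * su + 1) = (alpha - al) / 2.
    by rewrite /e1; field; rewrite gt_eqF//; lra.
  have eps0E : eps0 * (C * `|v| * su + 1) = (alpha - al) / 2.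
    by rewrite /eps0; field; rewrite gt_eqF.
  have -> : (e1 + eps0 * C) * `|v| * su = (alpha - al) - e1 - eps0.
    have -> : (e1 + eps0 * C) * `|v| * su =
      e1 * (`|v| * su + 1) + eps0 * (C * `|v| * su + 1) - e1 - eps0 by ring.
    by rewrite e1E eps0E -splitr.
  by lra.
Qed.

End MeanValue.

(** * Clarke differential *)

Section MatrixBounds.
Context {R : realType}.

Lemma det_norm_le n (A : 'M[R]_n) (L : R) : (forall i j, `|A i j| <= L) ->
  `|\det A| <= n`!%:R * L ^+ n.
Proof.
move=> AL; apply: le_trans (ler_norm_sum _ _ _) _.
apply: (@le_trans _ _ (\sum_(s : 'S_n) L ^+ n)); last first.
  by rewrite sumr_const card_Sn mulr_natl.
apply: ler_sum => s _; rewrite normrM normrX normrN1 expr1n mul1r normr_prod.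
rewrite -[n in L ^+ n]card_ord -prodr_const; apply: ler_prod => i _.
by rewrite normr_ge0 AL.
Qed.

Lemma adj_norm_le n (A : 'M[R]_n) (L : R) : (forall i j, `|A i j| <= L) ->
  forall i j, `|\adj A i j| <= n.-1`!%:R * L ^+ n.-1.
Proof.
move=> AL i j; rewrite mxE /cofactor normrM normrX normrN1 expr1n mul1r.
by apply: det_norm_le => k l; rewrite !mxE.
Qed.

(** The modulus of the determinant is the product of the moduli of the [n] complex eigenvalues,
    counted with multiplicity. *)
Lemma det_spec_ge n (A : 'M[R]_n) (eps : R) : 0 < eps ->
  (forall z : R[i], eigenvalue (map_mx (real_complex R) A) z -> ~ (`|z| <= eps%:C)) ->
  eps ^+ n <= `|\det A|.
Proof.
move=> eps0 H; pose Ac := map_mx (real_complex R) A.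
have [r rE] := closed_field_poly_normal (char_poly Ac).
have mon := char_poly_monic Ac; rewrite (monicP mon) scale1r in rE.
have sr : size r = n.
  by have := size_char_poly Ac; rewrite rE size_prod_XsubC => -[].
have r_eig z : z \in r -> eps%:C < `|z|.
  move=> zr; have /H/negP : eigenvalue Ac z by rewrite eigenvalue_root_char rE root_prod_XsubC.
  by rewrite real_ltNge// ?normr_real// realE ler0c ltW.
have detE : `|\det Ac| = \prod_(z <- r) `|z|.
  have := char_poly_det Ac; rewrite -horner_coef0 rE horner_prod => h.
  have -> : `|\det Ac| = `|(-1) ^+ n * \det Ac|.
    by rewrite normrM normrX normrN1 expr1n mul1r.
  rewrite -h normr_prod; apply: eq_bigr => z _.
  by rewrite !hornerE normrN.
have : (eps ^+ n)%:C <= `|\det Ac|.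
  rewrite detE rmorphXn/= -sr; elim: r {rE sr detE} r_eig => [|z r IH] r_eig.
    by rewrite big_nil expr0.
  rewrite big_cons exprS ler_pM ?exprn_ge0 ?ler0c ?(ltW eps0)//.
    by rewrite ltW// r_eig// mem_head.
  by apply: IH => w wr; rewrite r_eig// in_cons wr orbT.
by rewrite det_map_mx /= normc_def/= expr0n/= addr0 sqrtr_sqr lecR.
Qed.

End MatrixBounds.

(** * Euclidean product and separation from the origin *)

Section Dot.
Context {R : realType} {n : nat}.
Implicit Types (x y z u v w : 'rV[R]_n) (A : 'M[R]_n).

Definition dot x y : R := \sum_i x 0 i * y 0 i.

Lemma dotE x y : dot x y = (x *m y^T) 0 0.
Proof. by rewrite /dot mxE; apply: eq_bigr => i _; rewrite mxE. Qed.

Lemma dotC x y : dot x y = dot y x.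
Proof. by apply: eq_bigr => i _; rewrite mulrC. Qed.

Lemma dotDl x y z : dot (x + y) z = dot x z + dot y z.
Proof. by rewrite /dot -big_split/=; apply: eq_bigr => i _; rewrite mxE mulrDl. Qed.

Lemma dotZl (c : R) x z : dot (c *: x) z = c * dot x z.
Proof. by rewrite /dot mulr_sumr; apply: eq_bigr => i _; rewrite mxE mulrA. Qed.

Lemma dotNl x z : dot (- x) z = - dot x z.
Proof. by rewrite -scaleN1r dotZl mulN1r. Qed.

Lemma dotBl x y z : dot (x - y) z = dot x z - dot y z.
Proof. by rewrite dotDl dotNl. Qed.

Lemma dotDr x y z : dot z (x + y) = dot z x + dot z y.
Proof. by rewrite !(dotC z) dotDl. Qed.

Lemma dotZr (c : R) x z : dot z (c *: x) = c * dot z x.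
Proof. by rewrite !(dotC z) dotZl. Qed.

Lemma dot_mulmx x A y : dot (x *m A) y = dot x (y *m A^T).
Proof. by rewrite !dotE trmx_mul trmxK mulmxA. Qed.

Lemma dot_norm_le x y : `|dot x y| <= n%:R * `|x| * `|y|.
Proof.
apply: le_trans (ler_norm_sum _ _ _) _.
apply: (@le_trans _ _ (\sum_(i < n) `|x| * `|y|)); last first.
  by rewrite sumr_const card_ord -mulrA mulr_natl.
by apply: ler_sum => i _; rewrite normrM ler_pM// mx_entry_le.
Qed.

Lemma dot_ge0 x : 0 <= dot x x.
Proof. by apply: sumr_ge0 => i _; rewrite -expr2 sqr_ge0. Qed.

Lemma dot_ge_norm x : `|x| ^+ 2 <= dot x x.
Proof.
suff : `|x| <= Num.sqrt (dot x x).
  by move=> h; rewrite -[leRHS]sqr_sqrtr ?dot_ge0// lerXn2r ?nnegrE ?sqrtr_ge0.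
apply: mx_norm_leP => [|i j]; first exact: sqrtr_ge0.
rewrite ord1 -sqrtr_sqr ler_wsqrtr// /dot (bigD1 j)//= -expr2 lerDl.
by apply: sumr_ge0 => k _; rewrite -expr2 sqr_ge0.
Qed.

(* The separating vector is an almost nearest point of [C] to the origin, so
   neither closedness of [C] nor the existence of a nearest point is needed. *)
Lemma separation (C : set 'rV[R]_n) (c D : R) : 0 < c ->
  (forall x y (t : R), 0 <= t <= 1 -> C x -> C y -> C (x + t *: (y - x))) ->
  (forall z, C z -> dot z z <= D) -> (forall z, C z -> c <= dot z z) ->
  exists2 u, C u \/ u = 0 & forall z, C z -> c / 2 <= dot z u.
Proof.
move=> c0 conv CD Cc; have [[z1 Cz1]|/forallNP no] := pselect (exists z, C z); last first.
  by exists 0; [right|move=> z /no].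
have D0 : 0 < D by apply: lt_le_trans (CD _ Cz1); apply: lt_le_trans c0 (Cc _ Cz1).
pose S := [set dot z z | z in C].
have hS : has_inf S.
  by split; [exists (dot z1 z1), z1|exists c => _ [z /Cc ? <-]].
(* The slack of the almost minimiser [u] is [t * c / 2], and [dot (z - u) (z - u) <= 4 * D], so this
   [t] keeps the quadratic term below [t * c / 2] as well. *)
pose t := Num.min 1 (c / (8 * D)).
have t0 : 0 < t by rewrite lt_min ltr01 divr_gt0// mulr_gt0.
have tD : t * (8 * D) <= c by rewrite -ler_pdivlMr ?mulr_gt0// ge_min lexx orbT.
have tc0 : 0 < t * c / 2 by rewrite divr_gt0// mulr_gt0.
have [_ [u Cu <-] ulow] := inf_adherent tc0 hS.
exists u; [by left|move=> z Cz].
have t1 : 0 <= t <= 1 by rewrite ltW//= ge_min lexx.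
have h1 : inf S <= dot (u + t *: (z - u)) (u + t *: (z - u)).
  by apply: ge_inf; [case: hS|exists (u + t *: (z - u)) => //; exact: conv].
have E : dot (u + t *: (z - u)) (u + t *: (z - u)) =
  dot u u + 2 * t * (dot z u - dot u u) + t ^+ 2 * dot (z - u) (z - u).
  rewrite !(dotDl, dotDr, dotZl, dotZr, dotNl) (dotC u z) !(dotC _ (- u)) !dotNl (dotC u z).
  ring.
have zu : dot (z - u) (z - u) <= 4 * D.
  have : 0 <= dot (z + u) (z + u) by exact: dot_ge0.
  rewrite !(dotDl, dotDr, dotNl) !(dotC _ (- u)) !dotNl (dotC u z).
  have := CD _ Cz; have := CD _ Cu; lra.
have Cuu := Cc _ Cu; rewrite E in h1.
have h2 : t * (c / 2 + 2 * (dot z u - dot u u) + t * dot (z - u) (z - u)) > 0.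
  by move: h1 ulow; lra.
rewrite pmulr_rgt0// in h2.
have : t * dot (z - u) (z - u) <= t * (4 * D) by rewrite ler_pM2l.
by lra.
Qed.

End Dot.

Section UniformInverse.
Context {R : realType}.

(** [v *m A *m \adj A] is [\det A *: v], so bounded cofactors limit the contraction. The [+ 1] keeps
    the denominator positive, for instance when [n] is 0. *)
Lemma mulmx_lower n (A : 'M[R]_n) (L eps : R) : 0 <= L -> 0 < eps ->
  (forall i j, `|A i j| <= L) -> eps ^+ n <= `|\det A| ->
  forall v : 'rV[R]_n, eps ^+ n / (n%:R * (n.-1`!%:R * L ^+ n.-1) + 1) * `|v| <= `|v *m A|.
Proof.
move=> L0 eps0 AL detA v; set K := n.-1`!%:R * _.
have K0 : 0 <= K by rewrite mulr_ge0// exprn_ge0.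
have nK0 : 0 <= n%:R * K by rewrite mulr_ge0.
rewrite mulrAC ler_pdivrMr; last by lra.
apply: (@le_trans _ _ (`|\det A| * `|v|)); first by rewrite ler_wpM2r.
rewrite -normrZ -mul_mx_scalar -mul_mx_adj mulmxA.
apply: le_trans (mulmx_norm_le _ _) _; rewrite mulrC ler_wpM2l//.
have : `|\adj A| <= K by apply: mx_norm_leP => // i j; apply: adj_norm_le.
move=> /(ler_wpM2l (ler0n R n)); lra.
Qed.

End UniformInverse.

Section Clarke.
Context {R : realType} {n : nat}.
Variables (f : 'rV[R]_n -> 'rV[R]_n) (L : R).
Hypothesis L0 : 0 <= L.
Hypothesis lipf : forall x y, `|f x - f y| <= L * `|x - y|.
Implicit Types (x y p u v w : 'rV[R]_n) (A : 'M[R]_n).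

Lemma jacobian_entry_le p i j : differentiable f p -> `|'J f p i j| <= L.
Proof.
move=> dfp; apply/ler_addgt0Pr => e e0; have [d d0 dP] := differentiable_approx e0 dfp.
have := dP (d *: evec i); rewrite norm_evec gtr0_norm// lexx => /(_ isT) h.
have h2 := lipf (p + d *: evec i) p; rewrite addrAC subrr add0r norm_evec gtr0_norm// in h2.
have h3 : `|(d *: evec i) *m 'J f p| <= (L + e) * d.
  set a := f _ - f _ in h h2; rewrite -[X in `|X|](subKr a).
  by apply: le_trans (ler_normB _ _) _; rewrite mulrDl lerD.
have := le_trans (mx_entry_le _ 0 j) h3.
by rewrite -scalemxAl -rowE !mxE normrM gtr0_norm// mulrC ler_pM2r.
Qed.

Lemma limiting_jacobian_entry_le x A i j : limiting_jacobians f x A -> `|A i j| <= L.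
Proof.
move=> [u [_ du /cvgrPdist_le JA]]; apply/ler_addgt0Pr => e e0.
have [k _ /(_ k (leqnn k)) /= h] := JA e e0.
have := le_trans (mx_entry_le (A - 'J f (u k)) i j) h.
rewrite mxE [X in `|_ + X|]mxE => h2.
have h1 := jacobian_entry_le i j (du k).
rewrite -[A i j](subrK ('J f (u k) i j)); apply: le_trans (ler_normD _ _) _.
by rewrite [leRHS]addrC lerD.
Qed.

Lemma clarke_entry_le x A i j : clarke_diff f x A -> `|A i j| <= L.
Proof.
move=> [k [c [s [c0 c1 sS ->]]]]; rewrite summxE; apply: le_trans (ler_norm_sum _ _ _) _.
rewrite -[L]mul1r -c1 mulr_suml; apply: ler_sum => l _.
by rewrite mxE normrM ger0_norm// ler_wpM2l// (limiting_jacobian_entry_le _ _ (sS l)).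
Qed.

Lemma limiting_clarke x A : limiting_jacobians f x A -> clarke_diff f x A.
Proof.
move=> xA; exists 1%N, (fun=> 1), (fun=> A); split => //; first by rewrite big_ord1.
by rewrite big_ord1 scale1r.
Qed.

Lemma clarke_convex x A B (t : R) : 0 <= t <= 1 -> clarke_diff f x A -> clarke_diff f x B ->
  clarke_diff f x (A + t *: (B - A)).
Proof.
move=> /andP[t0 t1] [k [c [s [c0 c1 sS ->]]]] [l [d [r [d0 d1 rS ->]]]].
exists (k + l)%N, (fun i => match fintype.split i with inl i => (1 - t) * c i | inr i =>
  t * d i end).
exists (fun i => match fintype.split i with inl i => s i | inr i => r i end).
have lsh (i : 'I_k) : fintype.split (lshift l i) = inl i by exact: (unsplitK (inl i)).
have rsh (i : 'I_l) : fintype.split (rshift k i) = inr i by exact: (unsplitK (inr i)).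
split.
- by move=> i; case: (fintype.split i) => j; rewrite mulr_ge0// subr_ge0.
- rewrite big_split_ord/=; under eq_bigr do rewrite lsh; under [X in _ + X]eq_bigr do
  rewrite rsh.
  by rewrite -!mulr_sumr c1 d1 !mulr1 subrK.
- by move=> i; case: (fintype.split i) => j.
- rewrite big_split_ord/=; under [X in _ = X + _]eq_bigr do rewrite lsh -scalerA.
  under [X in _ = _ + X]eq_bigr do rewrite rsh -scalerA.
  by rewrite -!scaler_sumr scalerBl scale1r scalerBr addrA addrAC.
Qed.

(** Upper semicontinuity: Jacobians at points tending to [x] that stay [e] away from the limiting
    ones are bounded, hence have a limit along an ultrafilter. The indices [s] turn it into the
    limit of a genuine sequence, so it is itself a limiting Jacobian. *)
Lemma jacobian_near_limiting x (e : R) : 0 < e -> exists2 r : R, 0 < r &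
  forall p, `|p - x| <= r -> differentiable f p ->
  exists2 A, limiting_jacobians f x A & `|'J f p - A| <= e.
Proof.
move=> e0; apply: contrapT => no.
have /choice[p pP] (k : nat) : exists p, [/\ `|p - x| <= k.+1%:R^-1, differentiable f p &
    forall A, limiting_jacobians f x A -> ~ (`|'J f p - A| <= e)].
  apply: contrapT => /forallNP no'; apply: no; exists k.+1%:R^-1 => [|p px dp].
    by rewrite invr_gt0.
  apply: contrapT => no2; apply: (no' p); split => // A xA Ae.
  by apply: no2; exists A.
have [U [UU ooU]] := ultraFilterLemma (F := \oo) _.
have /choice[B /= BP] (ij : 'I_n * 'I_n) : exists l : R,
    forall d, 0 < d -> \forall k \near U, `|'J f (p k) ij.1 ij.2 - l| <= d.
  apply: (@ultra_bounded_limit _ _ _ (- L) L) => //; apply: nearW => k.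
  by have [_ dp _] := pP k; rewrite -ler_norml jacobian_entry_le.
pose A := \matrix_(i, j) B (i, j).
have AP (d : R) k0 : 0 < d -> exists2 k, (k0 <= k)%N & `|'J f (p k) - A| <= d.
  move=> d0; have : \forall k \near U, forall ij : 'I_n * 'I_n, `|'J f (p k) ij.1 ij.2 -
    B ij| <= d.
    by apply: filter_forall => ij; exact: BP.
  have geU : \forall m \near U, (k0 <= m)%N by apply: ooU; exists k0.
  move=> /(filterI geU)/filter_ex[k [kk kB]]; exists k => //.
  by apply: mx_norm_leP => [|i j]; [exact: ltW|rewrite mxE [X in `|_ + X|]mxE [X in `|_ -
    X|]mxE; exact: (kB (i, j))].
have /choice[s sP] (i : nat) : exists k, (i <= k)%N /\ `|'J f (p k) - A| <= i.+1%:R^-1.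
  by have [k ik kA] := AP (i.+1%:R^-1) i (ltac:(by rewrite invr_gt0)); exists k.
have harm (d : R) : 0 < d -> \forall i \near \oo, i.+1%:R^-1 <= d.
  move=> d0; exists (Num.trunc d^-1) => // i /= di.
  rewrite -[leRHS]invrK lef_pV2 ?posrE ?invr_gt0//; apply: ltW.
  by apply: lt_le_trans (truncnS_gt _) _; rewrite ler_nat.
have xA : limiting_jacobians f x A.
  exists (p \o s); split.
  - apply/cvgrPdist_le => d d0; apply: filterS (harm d d0) => i id /=.
    have [+ _ _] := pP (s i); rewrite distrC => /le_trans; apply; apply: le_trans id.
    by rewrite lef_pV2 ?posrE// ler_nat ltnS; have [] := sP i.
  - by move=> i /=; have [_ ? _] := pP (s i).
  - apply/cvgrPdist_le => d d0; apply: filterS (harm d d0) => i id /=.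
    by rewrite distrC; have [_ /le_trans] := sP i; apply.
have [k _ kA] := AP e 0%N e0.
by have [_ _ /(_ A xA)] := pP k.
Qed.

(** Otherwise the mean value inequality gives a point of differentiability near the segment, hence
    near [x], whose Jacobian is within [e] of a limiting one. The factors [n%:R] come from sup norm
    bounds of a matrix product and of [dot]. *)
Lemma clarke_increment x (e : R) : 0 < e -> exists2 r : R, 0 < r &
  forall y v w (alpha : R), v != 0 -> `|y - x| <= r -> `|y + v - x| <= r ->
  (forall A, limiting_jacobians f x A -> alpha <= dot (v *m A) w) ->
  alpha - n%:R * n%:R * e * `|v| * `|w| <= dot (f (y + v) - f y) w.
Proof.
move=> e0; have [r r0 rP] := jacobian_near_limiting x e0.
exists (r / 2) => [|y v w alpha vN0 yx yvx H]; first by rewrite divr_gt0.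
rewrite leNgt; apply/negP; set a := alpha - _ => lt.
rewrite dotE in lt.
have r20 : 0 < r / 2 by rewrite divr_gt0.
have [p [t [/andP[t0 t1] pt dp]]] := mean_value_differentiable L0 lipf vN0 r20 lt.
have px : `|p - x| <= r.
  have -> : p - x = (p - (y + t *: v)) + ((1 - t) *: (y - x) + t *: (y + v - x)).
    have -> : (1 - t) *: (y - x) + t *: (y + v - x) = y + t *: v - x.
      by apply/rowP => i; rewrite !mxE; ring.
    by rewrite addrA subrK.
  rewrite [r]splitr; apply: le_trans (ler_normD _ _) _; rewrite lerD//.
  apply: le_trans (ler_normD _ _) _; rewrite !normrZ !ger0_norm ?subr_ge0//.
  have h1 : (1 - t) * `|y - x| <= (1 - t) * (r / 2) by rewrite ler_wpM2l ?subr_ge0.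
  have h2 : t * `|y + v - x| <= t * (r / 2) by rewrite ler_wpM2l.
  by lra.
have [A xA JA] := rP p px dp.
rewrite -dotE => lt2; have := H A xA; apply/negP; rewrite -ltNge.
have -> : v *m A = v *m 'J f p - v *m ('J f p - A) by rewrite -mulmxBr subKr.
rewrite dotBl.
have := dot_norm_le (v *m ('J f p - A)) w; rewrite ler_norml => /andP[lo _].
have h3 : `|v *m ('J f p - A)| <= n%:R * e * `|v|.
  by apply: le_trans (mulmx_norm_le _ _) _; rewrite ler_wpM2r// ler_wpM2l.
have h4 : n%:R * `|v *m ('J f p - A)| * `|w| <= n%:R * (n%:R * e * `|v|) * `|w|.
  by rewrite ler_wpM2r// ler_wpM2l.
have aE : a = alpha - n%:R * (n%:R * e * `|v|) * `|w| by rewrite /a !mulrA.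
by move: lt2; rewrite aE; lra.
Qed.

End Clarke.

(** * Local injectivity and metric regularity *)

Lemma norm_lip_continuous {R : realType} (V W : normedModType R) (f : V -> W) (L : R) :
  0 <= L -> (forall x y, `|f x - f y| <= L * `|x - y|) -> continuous f.
Proof.
move=> L0 lipf x; apply/(@cvgrPdist_le _ _ _ (nbhs x)) => e e0.
have L1 : 0 < L + 1 by lra.
apply/nbhs_ballP; exists (e / (L + 1)) => [|y]; first exact: divr_gt0.
rewrite -ball_normE/= ltr_pdivlMr// => xy; apply: le_trans (lipf _ _) _.
by have := normr_ge0 (x - y); lra.
Qed.

Section LocalInverse.
Context {R : realType} {n : nat}.
Variables (f : 'rV[R]_n -> 'rV[R]_n) (L kap : R).
Hypothesis L0 : 0 <= L.
Hypothesis lipf : forall x y, `|f x - f y| <= L * `|x - y|.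
Hypothesis kap0 : 0 < kap.
Hypothesis lower : forall x A, clarke_diff f x A ->
  forall v : 'rV[R]_n, kap * `|v| <= `|v *m A| /\ kap * `|v| <= `|v *m A^T|.
Implicit Types (x y z p u v w : 'rV[R]_n).

(** Used with [T] the identity and the transposition. The separating vector lies in the separated
    set or is 0, whence the bound on its norm. *)
Lemma clarke_separation (T : 'M[R]_n -> 'M[R]_n) x v : v != 0 ->
  (forall A B (t : R), T (A + t *: (B - A)) = T A + t *: (T B - T A)) ->
  (forall A, clarke_diff f x A -> kap * `|v| <= `|v *m T A|) ->
  (forall A, clarke_diff f x A -> `|T A| <= L) ->
  exists2 w, `|w| <= n%:R * L * `|v| &
    forall A, clarke_diff f x A -> kap ^+ 2 * `|v| ^+ 2 / 2 <= dot (v *m T A) w.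
Proof.
move=> vN0 Tconv Tlow Tbnd; have v0 : 0 < `|v| by rewrite normr_gt0.
have nrm A : clarke_diff f x A -> `|v *m T A| <= n%:R * L * `|v|.
  move=> xA; apply: le_trans (mulmx_norm_le _ _) _.
  by rewrite ler_wpM2r// ler_wpM2l// Tbnd.
have nLv0 : 0 <= n%:R * L * `|v| by rewrite !mulr_ge0.
pose C := [set v *m T A | A in clarke_diff f x].
have [||||w Cw H] := @separation _ _ C (kap ^+ 2 * `|v| ^+ 2) (n%:R * (n%:R * L * `|v|) ^+ 2).
- by rewrite mulr_gt0// exprn_gt0.
- move=> _ _ t t01 [A xA <-] [B xB <-]; exists (A + t *: (B - A)); first exact: clarke_convex.
  by rewrite Tconv mulmxDr -scalemxAr mulmxBr.
- move=> _ [A xA <-]; apply: le_trans (ler_norm _) _; apply: le_trans (dot_norm_le _ _) _.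
  by rewrite -mulrA -expr2 ler_wpM2l// lerXn2r ?nnegrE// nrm.
- move=> _ [A xA <-]; apply: le_trans (dot_ge_norm _); rewrite -exprMn lerXn2r ?nnegrE//.
    by rewrite mulr_ge0// ltW.
  exact: Tlow.
exists w => [|B xB]; last by apply: H; exists B.
by case: Cw => [[A xA <-]|->]; rewrite ?normr0// nrm.
Qed.

Lemma clarke_norm_le x A : clarke_diff f x A -> `|A| <= L.
Proof. by move=> xA; apply: mx_norm_leP => // i j; apply: clarke_entry_le xA. Qed.

Lemma clarke_sep_row x v : v != 0 -> exists2 w, `|w| <= n%:R * L * `|v| &
  forall A, clarke_diff f x A -> kap ^+ 2 * `|v| ^+ 2 / 2 <= dot (v *m A) w.
Proof.
move=> vN0; apply: (@clarke_separation id x v vN0) => // A xA; last exact: clarke_norm_le xA.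
by have [] := lower xA v.
Qed.

Lemma clarke_sep_col x u : u != 0 -> exists2 v, `|v| <= n%:R * L * `|u| &
  forall A, clarke_diff f x A -> kap ^+ 2 * `|u| ^+ 2 / 2 <= dot (v *m A) u.
Proof.
move=> uN0; have [|A xA|A xA|v vu vP] := @clarke_separation trmx x u uN0.
- by move=> A B t; rewrite linearD/= linearZ/= linearB.
- by have [] := lower xA u.
- apply: mx_norm_leP => // i j; rewrite mxE; exact: clarke_entry_le xA.
- by exists v => // A /vP; rewrite dotC -dot_mulmx.
Qed.

(** Without limiting Jacobians the hypothesis of [clarke_increment] is vacuous, so [alpha] can be
    taken too large for its conclusion. *)
Lemma limiting_nonempty x v : v != 0 -> exists A, limiting_jacobians f x A.
Proof.
move=> vN0; apply: contrapT => /forallNP no.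
have [r r0 rP] := clarke_increment L0 lipf x (ltr01 : 0 < 1 :> R).
have v0 : 0 < `|v| by rewrite normr_gt0.
pose v' := (r / `|v|) *: v.
have v'r : `|v'| = r by rewrite normrZ gtr0_norm ?divr_gt0// divfK// gt_eqF.
have v'N0 : v' != 0 by rewrite -normr_gt0 v'r.
have := rP x v' v' (1 + dot (f (x + v') - f x) v' + n%:R * n%:R * 1 * `|v'| * `|v'|) v'N0.
rewrite subrr normr0 ltW// addrAC subrr add0r v'r lexx => /(_ isT isT).
by move=> /(_ (fun A xA => False_ind _ (no A xA))); lra.
Qed.

Let n3L := n%:R * n%:R * (n%:R * L).
(** With [|w| <= n%:R * L * |v|], this tolerance makes the error in [clarke_increment] at most half
    of the [kap ^+ 2 * |v| ^+ 2 / 2] obtained by separation. *)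
Let del := kap ^+ 2 / (4 * (n3L + 1)).

Let n3L0 : 0 <= n3L. Proof. by rewrite !mulr_ge0. Qed.
Let del0 : 0 < del. Proof. by rewrite divr_gt0 ?exprn_gt0// mulr_gt0//; have := n3L0; lra. Qed.
Let delP : n3L * del <= kap ^+ 2 / 4.
Proof.
have n3L0' := n3L0; have : del * (n3L + 1) = kap ^+ 2 / 4 by rewrite /del; field; rewrite
  gt_eqF//; lra.
by have := del0; lra.
Qed.

Definition inj_const := kap ^+ 2 / (4 * (n%:R * n%:R * L + 1)).

Lemma inj_const_gt0 : 0 < inj_const.
Proof.
rewrite divr_gt0 ?exprn_gt0// mulr_gt0//.
have : 0 <= n%:R * n%:R * L by rewrite !mulr_ge0.
lra.
Qed.

Lemma local_injectivity x : exists2 r : R, 0 < r & forall y z,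
  `|y - x| <= r -> `|z - x| <= r -> inj_const * `|z - y| <= `|f z - f y|.
Proof.
have [r r0 rP] := clarke_increment L0 lipf x del0; exists r => // y z yx zx.
have [->|zN] := eqVneq z y; first by rewrite !subrr !normr0 mulr0.
pose v := z - y; have vN0 : v != 0 by rewrite subr_eq0.
have v0 : 0 < `|v| by rewrite normr_gt0.
have [w wv wP] := clarke_sep_row x vN0.
have yvz : y + v = z by rewrite addrC subrK.
have := rP y v w (kap ^+ 2 * `|v| ^+ 2 / 2) vN0 yx; rewrite yvz => /(_ zx) h.
have {}h := h (fun A xA => wP A (limiting_clarke xA)).
have h1 := le_trans h (le_trans (ler_norm _) (dot_norm_le _ _)).
have h2 : n%:R * n%:R * del * `|v| * `|w| <= kap ^+ 2 / 4 * `|v| ^+ 2.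
  apply: (@le_trans _ _ (n%:R * n%:R * del * `|v| * (n%:R * L * `|v|))).
    by apply: ler_wpM2l => //; apply: mulr_ge0 => //; apply: mulr_ge0; [exact:
      mulr_ge0|exact: ltW del0].
  have -> : n%:R * n%:R * del * `|v| * (n%:R * L * `|v|) = n3L * del * `|v| ^+ 2 by
    rewrite /n3L; ring.
  by rewrite ler_wpM2r ?exprn_ge0.
have h3 : n%:R * `|f z - f y| * `|w| <= n%:R * n%:R * L * `|f z - f y| * `|v|.
  have -> : n%:R * n%:R * L * `|f z - f y| * `|v| = n%:R * `|f z - f y| * (n%:R * L *
    `|v|) by ring.
  by rewrite ler_wpM2l// mulr_ge0.
have h4 : kap ^+ 2 / 4 * `|v| <= n%:R * n%:R * L * `|f z - f y|.
  rewrite -(ler_pM2r v0) -mulrA -expr2; move: h1 h2 h3; lra.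
have nnL0 : 0 <= n%:R * n%:R * L by rewrite !mulr_ge0.
rewrite /inj_const -/v mulrAC ler_pdivrMr; last by rewrite mulr_gt0//; lra.
have := normr_ge0 (f z - f y); move: h4; lra.
Qed.

(** [inj_const] is the same at all points; only the radius has to be made uniform, by compactness of
    the ball containing [y]. *)
Lemma uniform_injectivity (rho : R) : exists2 r : R, 0 < r & forall y z,
  `|y| <= rho -> `|z - y| <= r -> inj_const * `|z - y| <= `|f z - f y|.
Proof.
apply: contrapT => no.
have /choice[p pP] (k : nat) : exists p : 'rV[R]_n * 'rV[R]_n,
    [/\ `|p.1| <= rho, `|p.2 - p.1| <= k.+1%:R^-1 & ~ (inj_const * `|p.2 - p.1| <= `|f
      p.2 - f p.1|)].
  apply: contrapT => /forallNP no'; apply: no; exists k.+1%:R^-1 => [|y z yr zy].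
    by rewrite invr_gt0.
  by apply: contrapT => no2; apply: (no' (y, z)).
have cpt : compact [set v : 'rV[R]_n | forall i, v ord0 i \in `[- rho, rho]].
  by apply: (@rV_compact R n (fun=> `[(- rho), rho]%classic)) => _; exact: segment_compact.
have [|x [_ clx]] := cpt ((fst \o p) @ \oo) (fmap_proper_filter _ _).
  exists 0%N => // k _ i /=; rewrite in_itv/= -ler_norml; have [h _ _] := pP k.
  exact: le_trans (mx_entry_le _ _ _) h.
have [r r0 rP] := local_injectivity x; have r20 : 0 < r / 2 by rewrite divr_gt0.
pose k0 := Num.trunc (r / 2)^-1.
have [|_ [[k k0k <-] pr]] := clx [set (fst \o p) k | k in [set k | (k0 <= k)%N]] (ball x
  (r / 2)) _ (nbhsx_ballx x _ r20).
  by exists k0 => // k /= k0k; exists k.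
have [h1 h2] := pP k; apply; apply: rP.
  by move: pr; rewrite -ball_normE/= distrC => pr; lra.
have k2 : k.+1%:R^-1 <= r / 2.
  rewrite -[leRHS]invrK lef_pV2 ?posrE ?invr_gt0//; apply: ltW.
  by apply: lt_le_trans (truncnS_gt _) _; rewrite ler_nat.
have -> : (p k).2 - x = ((p k).2 - (p k).1) + ((p k).1 - x) by rewrite addrA subrK.
apply: le_trans (ler_normD _ _) _; move: pr; rewrite -ball_normE/= distrC => pr.
by rewrite [r]splitr; apply: lerD; [exact: le_trans h2 k2|exact: ltW].
Qed.

End LocalInverse.

Lemma dot_sqrB {R : realType} n (u d : 'rV[R]_n) :
  dot (u - d) (u - d) = dot u u - 2 * dot d u + dot d d.
Proof. by rewrite dotBl !(dotC _ (u - d)) !dotBl (dotC u d); ring. Qed.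

Lemma continuous_subr {R : realType} (V : normedModType R) (T : topologicalType)
  (g : T -> V) (a : V) : continuous g -> continuous (fun z => g z - a).
Proof. by move=> gc z; apply: cvgB; [exact: gc|exact: cvg_cst]. Qed.

Lemma norm_fun_continuous {R : realType} (V : normedModType R) (T : topologicalType)
  (g : T -> V) : continuous g -> continuous (fun z => `|g z|).
Proof.
move=> gc z; apply: (@continuous_comp _ _ _ g Num.norm); [exact: gc|exact: norm_continuous].
Qed.

Lemma euclid_continuous {R : realType} n (T : topologicalType) (g : T -> 'rV[R]_n) :
  continuous g -> continuous (fun z => Num.sqrt (dot (g z) (g z))).
Proof.
move=> gc z; apply: (@continuous_comp _ _ _ (fun z => dot (g z) (g z)) Num.sqrt); last first.
  exact: sqrt_continuous.
apply: (@continuous_big _ _ (@GRing.add R) 0 xpredT); first exact: add_continuous.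
move=> i _ w; have c1 : g z 0 i @[z --> w] --> g w 0 i.
  apply: (@continuous_comp _ _ _ g (fun v : 'rV[R]_n => v 0 i)); first exact: gc.
  exact: coord_continuous.
exact: cvgM.
Qed.

Lemma euclid_objective_continuous {R : realType} n (V : normedModType R)
  (g : V -> 'rV[R]_n) (c : R) x y : continuous g ->
  continuous (fun z => Num.sqrt (dot (g z - y) (g z - y)) + c * `|z - x|).
Proof.
move=> gc z; apply: cvgD.
  have h := @euclid_continuous R n _ (fun z => g z - y) (continuous_subr gc) z.
  exact: h.
apply: cvgM; first exact: cvg_cst.
have h := @norm_fun_continuous R V V (fun z => z - x) (continuous_subr (fun u => cvg_id)) z.
exact: h.
Qed.

Lemma closed_norm_ball {R : realType} (V : normedModType R) (x : V) (r : R) :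
  closed [set z : V | `|z - x| <= r].
Proof.
apply: (@closed_comp _ _ (fun z : V => `|z - x|) [set y : R | y <= r]).
  move=> z _; have h := @norm_fun_continuous R V V (fun z => z - x)
    (continuous_subr (fun u => cvg_id)) z.
  exact: h.
exact: closed_le.
Qed.

Section MetricRegularity.
Context {R : realType} {n : nat}.
Variables (f : 'rV[R]_n -> 'rV[R]_n) (L kap : R).
Hypothesis L0 : 0 <= L.
Hypothesis lipf : forall x y, `|f x - f y| <= L * `|x - y|.
Hypothesis kap0 : 0 < kap.
Hypothesis lower : forall x A, clarke_diff f x A ->
  forall v : 'rV[R]_n, kap * `|v| <= `|v *m A| /\ kap * `|v| <= `|v *m A^T|.
Implicit Types (x y z p u v w : 'rV[R]_n).

(** The residual is measured in the Euclidean norm, whose square has a first order term given by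
    [dot]; a positive product need not decrease the sup norm. *)
Let enorm u := Num.sqrt (dot u u).

Let enorm_sqr u : enorm u ^+ 2 = dot u u.
Proof. by rewrite sqr_sqrtr// dot_ge0. Qed.

Let enorm_le u : enorm u <= n%:R * `|u|.
Proof.
rewrite -[leRHS]ger0_norm ?mulr_ge0// -sqrtr_sqr ler_wsqrtr//.
apply: le_trans (ler_norm _) _; apply: le_trans (dot_norm_le _ _) _.
rewrite exprMn -mulrA -expr2 ler_wpM2r ?exprn_ge0//.
by case: (n) => [|m]; rewrite ?expr0n// expr2 ler_peMl// ler1n.
Qed.

Let sigma := kap ^+ 2 / (8 * (n%:R * n%:R * L + 1)).

Let nnL0 : 0 <= n%:R * n%:R * L. Proof. by rewrite !mulr_ge0. Qed.

Let sigma0 : 0 < sigma.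
Proof. by rewrite divr_gt0 ?exprn_gt0// mulr_gt0//; have := nnL0; lra. Qed.

Let sigmaP : sigma * (n%:R * n%:R * L) < kap ^+ 2 / 4.
Proof.
have nnL0' := nnL0; have s0 := sigma0.
have sE : sigma * (n%:R * n%:R * L + 1) = kap ^+ 2 / 8.
  by rewrite /sigma; field; rewrite gt_eqF//; lra.
have : 0 < kap ^+ 2 by rewrite exprn_gt0.
by lra.
Qed.

(** Moving by [- t *: v] lowers the squared Euclidean residual by at least [2 * (t * k)], up to a
    term quadratic in [t]. After squaring, the claim at first order is [N * b < k], which [sigmaP]
    guarantees. *)
Lemma descent z y : f z != y -> exists v (t0 : R), 0 < t0 /\
  forall t, 0 < t <= t0 -> enorm (f (z - t *: v) - y) + sigma * (t * `|v|) < enorm (f z - y).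
Proof.
move=> fzy; pose u := f z - y; have uN0 : u != 0 by rewrite subr_eq0.
have u0 : 0 < `|u| by rewrite normr_gt0.
have [v vu vP] := clarke_sep_col L0 lipf kap0 lower z uN0.
pose n3L := n%:R * n%:R * (n%:R * L).
have n3L0 : 0 <= n3L by rewrite !mulr_ge0.
pose del := kap ^+ 2 / (4 * (n3L + 1)).
have del0 : 0 < del by rewrite divr_gt0 ?exprn_gt0// mulr_gt0//; lra.
have delP : n3L * del <= kap ^+ 2 / 4.
  have : del * (n3L + 1) = kap ^+ 2 / 4 by rewrite /del; field; rewrite gt_eqF//; lra.
  by lra.
have [r r0 rP] := clarke_increment L0 lipf z del0.
have vN0 : v != 0.
  have [A /limiting_clarke/vP] := limiting_nonempty L0 lipf z uN0.
  apply: contraTN => /eqP ->; rewrite mul0mx (_ : dot 0 u = 0); last first.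
    by rewrite -(scale0r u) dotZl mul0r.
  by rewrite -ltNge divr_gt0// mulr_gt0 ?exprn_gt0.
have v0 : 0 < `|v| by rewrite normr_gt0.
pose N := enorm u; pose b := sigma * `|v|; pose M := n%:R * (L * `|v|) ^+ 2.
pose k := kap ^+ 2 * `|u| ^+ 2 / 4.
have N0 : 0 < N by rewrite sqrtr_gt0; apply: lt_le_trans (dot_ge_norm _); rewrite exprn_gt0.
have b0 : 0 < b by rewrite mulr_gt0.
have M0 : 0 <= M by rewrite mulr_ge0// exprn_ge0// mulr_ge0.
have Nbk : N * b < k.
  apply: (@le_lt_trans _ _ (n%:R * `|u| * (sigma * (n%:R * L * `|u|)))).
    apply: ler_pM; [exact: ltW|exact: ltW|exact: enorm_le|].
    by apply: ler_wpM2l => //; exact: ltW.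
  have -> : n%:R * `|u| * (sigma * (n%:R * L * `|u|)) = sigma * (n%:R * n%:R * L) * `|u|
    ^+ 2 by ring.
  have -> : k = kap ^+ 2 / 4 * `|u| ^+ 2 by rewrite /k; ring.
  by rewrite ltr_pM2r ?exprn_gt0.
(* The three bounds keep the step within the radius [r], make [N - t * b] positive, and let the
   first order gain dominate the quadratic term. *)
pose t0 := Num.min (r / `|v|) (Num.min (N / (2 * b)) ((k - N * b) / (M + 1))).
have t00 : 0 < t0.
  rewrite !lt_min; apply/and3P; split; [exact: divr_gt0| |].
    by rewrite divr_gt0// mulr_gt0.
  by rewrite divr_gt0 ?subr_gt0//; lra.
exists v, t0; split => // t /andP[t_0 tt0].
have tr : t * `|v| <= r.
  have : t <= r / `|v| by apply: le_trans tt0 _; rewrite ge_min lexx.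
  by rewrite ler_pdivlMr.
have tN : t * (2 * b) <= N.
  have : t <= N / (2 * b) by apply: le_trans tt0 _; rewrite !ge_min lexx orbT.
  by rewrite ler_pdivlMr// mulr_gt0.
have tM : t * (M + 1) <= k - N * b.
  have : t <= (k - N * b) / (M + 1) by apply: le_trans tt0 _; rewrite !ge_min lexx !orbT.
  by rewrite ler_pdivlMr//; lra.
pose z' := z - t *: v; pose d := f z - f z'.
have dk : t * k <= dot d u.
  have tvN0 : t *: v != 0 by rewrite scaler_eq0 negb_or vN0 gt_eqF.
  have := rP z' (t *: v) u (t * (kap ^+ 2 * `|u| ^+ 2 / 2)) tvN0.
  rewrite subrK subrr normr0 (ltW r0) {1}/z' addrAC subrr add0r normrN normrZ gtr0_norm// tr.
  move=> /(_ isT isT) h.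
  have {}h : t * (kap ^+ 2 * `|u| ^+ 2 / 2) - n%:R * n%:R * del * (t * `|v|) * `|u| <= dot d u.
    apply: h => A zA; rewrite -scalemxAl dotZl ler_pM2l//.
    by apply: vP; exact: limiting_clarke.
  apply: le_trans h.
  have h2 : n%:R * n%:R * del * (t * `|v|) * `|u| <= t * k.
    apply: (@le_trans _ _ (n%:R * n%:R * del * (t * (n%:R * L * `|u|)) * `|u|)).
      rewrite ler_wpM2r//; apply: ler_wpM2l; last by rewrite ler_pM2l.
      by apply: mulr_ge0; [exact: mulr_ge0|exact: ltW].
    have -> : n%:R * n%:R * del * (t * (n%:R * L * `|u|)) * `|u| = t * (n3L * del * `|u| ^+ 2).
      by rewrite /n3L; ring.
    rewrite ler_pM2l// (_ : k = kap ^+ 2 / 4 * `|u| ^+ 2); last by rewrite /k; ring.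
    by rewrite ler_wpM2r ?exprn_ge0.
  have -> : t * (kap ^+ 2 * `|u| ^+ 2 / 2) = t * k + t * k by rewrite /k; field.
  by lra.
have u'E : f z' - y = u - d by rewrite /u /d; apply/rowP => i; rewrite !mxE; ring.
have dd : dot d d <= t ^+ 2 * M.
  apply: le_trans (ler_norm _) _; apply: le_trans (dot_norm_le _ _) _.
  have dn : `|d| <= t * (L * `|v|).
    apply: le_trans (lipf _ _) _; rewrite /z' subKr normrZ gtr0_norm//.
    by rewrite mulrCA.
  have -> : n%:R * `|d| * `|d| = n%:R * `|d| ^+ 2 by ring.
  have -> : t ^+ 2 * M = n%:R * (t * (L * `|v|)) ^+ 2 by rewrite /M; ring.
  rewrite ler_wpM2l// lerXn2r ?nnegrE//.
  by rewrite !mulr_ge0// ltW.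
rewrite -/z' u'E -/N.
have N'2 : enorm (u - d) ^+ 2 <= N ^+ 2 - 2 * (t * k) + t ^+ 2 * M.
  rewrite /N !enorm_sqr dot_sqrB; lra.
have tb : t * b < N by lra.
rewrite -/(b) (_ : sigma * (t * `|v|) = t * b); last by rewrite /b; ring.
rewrite -ltrBrDr -(@ltr_pXn2r _ 2%N) ?nnegrE ?sqrtr_ge0//; last by lra.
apply: le_lt_trans N'2 _.
have -> : (N - t * b) ^+ 2 = N ^+ 2 - 2 * (t * (N * b)) + (t * b) ^+ 2 by ring.
have h1 : t * (t * (M + 1)) <= t * (k - N * b) by rewrite ler_pM2l.
have h2 : 0 < t * (k - N * b) by rewrite mulr_gt0// subr_gt0.
have h3 := sqr_ge0 (t * b); have h4 := sqr_ge0 t.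
rewrite expr2 in h4; rewrite [t ^+ 2]expr2; lra.
Qed.

Definition reg_const := n%:R / sigma.

Lemma reg_const_ge0 : 0 <= reg_const.
Proof. by rewrite divr_ge0// ltW// sigma0. Qed.

(** Outside [B] the penalty alone exceeds [Psi x], so a minimiser over the compact [B] is global. If
    [f z] differed from [y], [descent] would lower the residual by more than the penalty can grow.
    Comparison with [Psi x] bounds the distance. *)
Lemma metric_regularity x y : exists2 z, f z = y & `|z - x| <= reg_const * `|f x - y|.
Proof.
pose Psi z := enorm (f z - y) + sigma * `|z - x|.
pose B := [set z : 'rV[R]_n | `|z - x| <= Psi x / sigma].
have Psix : Psi x = enorm (f x - y) by rewrite /Psi subrr normr0 mulr0 addr0.
have Psi0 : 0 <= Psi x by rewrite Psix sqrtr_ge0.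
have xB : B x by rewrite /B/= subrr normr0 divr_ge0// ltW// sigma0.
have cB : compact B.
  apply: bounded_closed_compact.
    exists (Psi x / sigma + `|x|); split; first by rewrite num_real.
    move=> M MM z zB; apply: le_trans (ltW MM).
    by rewrite -[z](subrK x); apply: le_trans (ler_normD _ _) _; rewrite lerD2r.
  exact: closed_norm_ball.
have [z zB zmin] : exists2 z, z \in B & forall t, t \in B -> Psi z <= Psi t.
  apply: EVT_min_rV => //; first by exists x.
  apply: continuous_subspaceT; apply: euclid_objective_continuous.
  exact: norm_lip_continuous lipf.
have zmin' t : Psi z <= Psi t.
  have [tB|] := leP `|t - x| (Psi x / sigma); first by apply: zmin; rewrite inE.
  rewrite ltr_pdivrMr ?sigma0// mulrC => /ltW h.
  apply: le_trans (zmin x _) _; first by rewrite inE.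
  by apply: le_trans h _; rewrite lerDr sqrtr_ge0.
exists z.
  apply/eqP; apply: contrapT => /negP fzy.
  have [v [t0 [t00 dP]]] := descent fzy.
  have := dP t0; rewrite t00 lexx => /(_ isT) h.
  have := zmin' (z - t0 *: v); rewrite leNgt => /negP; apply; rewrite /Psi.
  have : `|z - t0 *: v - x| <= `|z - x| + t0 * `|v|.
    by rewrite addrAC; apply: le_trans (ler_normB _ _) _; rewrite normrZ gtr0_norm.
  move=> /(ler_wpM2l (ltW sigma0)); lra.
have : sigma * `|z - x| <= n%:R * `|f x - y|.
  apply: le_trans (enorm_le _); rewrite -Psix; apply: le_trans (zmin' x).
  by rewrite lerDr sqrtr_ge0.
have -> : reg_const * `|f x - y| = n%:R * `|f x - y| / sigma by rewrite [LHS]mulrAC.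
by rewrite ler_pdivlMr ?sigma0// mulrC.
Qed.

End MetricRegularity.

(* If [f a = f b], contract the image of the segment from [a] to [b] linearly to
   the point [f a] and lift the (discretised) contraction: the lifts of the two
   end points stay at [a] and [b], while the lift of the constant path is
   constant because consecutive lifted points remain close to each other. *)
Lemma regular_injective {R : realType} (V : normedModType R) (f : V -> V) (L c1 Cm : R) :
  0 <= L -> (forall x y, `|f x - f y| <= L * `|x - y|) -> 0 < c1 -> 0 <= Cm ->
  (forall rho : R, exists2 r : R, 0 < r & forall y z, `|y| <= rho -> `|z - y| <= r ->
     c1 * `|z - y| <= `|f z - f y|) ->
  (forall x y, exists2 z, f z = y & `|z - x| <= Cm * `|f x - y|) ->
  injective f.
Proof.
move=> L0 lipf c10 Cm0 Hinj Hreg a b fab; pose y0 := f a.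
pose D := L * `|b - a|; have D0 : 0 <= D by rewrite mulr_ge0.
(* All lifted points have norm at most [rho], so one radius [r] serves the whole construction. *)
pose rho := `|a| + `|b - a| + Cm * D.
have [r r0 rP] := Hinj rho.
(* Times the mesh [h], the terms are the gap between neighbours on the initial segment, their gap
   after local injectivity, and the displacement of two neighbours in one stage. *)
pose B := `|b - a| + D / c1 + 2 * (Cm * D).
have Dc0 : 0 <= D / c1 by rewrite divr_ge0// ltW.
have CD0 : 0 <= Cm * D by rewrite mulr_ge0.
pose N := (Num.trunc (B / r)).+1; pose h : R := N%:R^-1.
have N0 : 0 < N%:R :> R by [].
have h0 : 0 < h by rewrite invr_gt0.
have Nh : N%:R * h = 1 by rewrite mulfV// gt_eqF.
have Br : B * h <= r.
  rewrite ler_pdivrMr// mulrC -ler_pdivrMr//; apply: ltW; exact: truncnS_gt.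
have bah : `|b - a| * h <= r.
  apply: le_trans Br; rewrite ler_pM2r// /B -addrA lerDl; lra.
have stepr : (D / c1 + 2 * (Cm * D)) * h <= r.
  by apply: le_trans Br; rewrite ler_pM2r// /B -addrA lerDr.
pose gam (j : nat) := a + (j%:R * h) *: (b - a).
have gam0 : gam 0%N = a by rewrite /gam mul0r scale0r addr0.
have gamN : gam N = b by rewrite /gam Nh scale1r addrC subrK.
have gamS j : gam j.+1 - gam j = h *: (b - a).
  by rewrite /gam opprD addrACA subrr add0r -scalerBl -mulrBl -natr1 addrAC subrr add0r mul1r.
have jh j : (j <= N)%N -> j%:R * h <= 1 by move=> jN; rewrite -[leRHS]Nh ler_pM2r// ler_nat.
have gam_a j : (j <= N)%N -> `|gam j - a| <= `|b - a|.
  move=> jN; rewrite /gam addrAC subrr add0r normrZ ger0_norm ?mulr_ge0 ?(ltW h0)//.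
  by rewrite ler_piMl// jh.
have fgam j : (j <= N)%N -> `|f (gam j) - y0| <= D.
  by move=> jN; apply: le_trans (lipf _ _) _; rewrite ler_wpM2l// gam_a.
have fgamS j : `|f (gam j.+1) - f (gam j)| <= D * h.
  by apply: le_trans (lipf _ _) _; rewrite gamS normrZ gtr0_norm// /D [h * _]mulrC mulrA.
pose tgt i j := y0 + (1 - i%:R * h) *: (f (gam j) - y0).
have tgtS i j : tgt i j - tgt i.+1 j = h *: (f (gam j) - y0).
  rewrite /tgt opprD addrACA subrr add0r -scalerBl; congr (_ *: _).
  by rewrite -natr1; ring.
pose lifted i (X : nat -> V) := [/\ X 0%N = a, X N = b,
  forall j, (j <= N)%N -> f (X j) = tgt i j /\ `|X j - gam j| <= Cm * D * (i%:R * h) &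
  forall j, (j < N)%N -> `|X j.+1 - X j| <= r].
(* A bootstrap: neighbours known to be within [r] are as close as their images allow, up to [c1^-1].
   This bound does not accumulate from stage to stage. *)
have close i X j : (i <= N)%N -> lifted i X -> (j < N)%N ->
    `|X j.+1 - X j| <= c1^-1 * `|tgt i j.+1 - tgt i j|.
  move=> iN [_ _ XP Xr] jN; have [fj Xj] := XP j (ltnW jN); have [fj1 _] := XP j.+1 jN.
  rewrite ler_pdivlMl// -fj -fj1; apply: rP; last exact: Xr.
  have -> : X j = a + (gam j - a) + (X j - gam j).
    by rewrite [a + _]addrC subrK addrC subrK.
  apply: le_trans (ler_normD _ _) _; rewrite /rho lerD//.
    by apply: le_trans (ler_normD _ _) _; rewrite lerD// gam_a// ltnW.
  by apply: le_trans Xj _; rewrite ler_piMr// jh.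
have lift i : (i <= N)%N -> exists X, lifted i X.
  elim: i => [_|i IH iN].
    exists gam; split => // j jN; last by rewrite gamS normrZ gtr0_norm// mulrC.
    rewrite subrr normr0 mul0r mulr0; split => //.
    by rewrite /tgt mul0r subr0 scale1r addrC subrK.
  have [X liftX] := IH (ltnW iN); have [X0 XN XP Xr] := liftX.
  have /choice[Y YP] j : exists z, f z = tgt i.+1 j /\ `|z - X j| <= Cm * `|f (X j) - tgt
    i.+1 j|.
    by have [z ? ?] := Hreg (X j) (tgt i.+1 j); exists z.
  have mv j : (j <= N)%N -> `|Y j - X j| <= Cm * (h * `|f (gam j) - y0|).
    move=> jN; have [_] := YP j; have [-> _] := XP j jN.
    by rewrite tgtS normrZ gtr0_norm.
  have mvD j : (j <= N)%N -> `|Y j - X j| <= Cm * D * h.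
    move=> jN; apply: le_trans (mv j jN) _; rewrite -mulrA ler_wpM2l// mulrC ler_pM2r//.
    exact: fgam.
  (* The displacement is controlled by the distance from [f (gam j)] to [y0], which vanishes at both
     end points. *)
  have fixed j : (j <= N)%N -> f (gam j) = y0 -> Y j = X j.
    move=> jN fj; apply/eqP; rewrite -subr_eq0 -normr_le0; apply: le_trans (mv j jN) _.
    by rewrite fj subrr normr0 !mulr0.
  exists Y; split.
  - by rewrite fixed// gam0.
  - by rewrite fixed// gamN -fab.
  - move=> j jN; split; first by have [] := YP j.
    have [_ Xj] := XP j jN; rewrite -(subrK (X j) (Y j)) -addrA.
    apply: le_trans (ler_normD _ _) _; rewrite -natr1 mulrDl mul1r mulrDr [leRHS]addrC.
    by apply: lerD => //; exact: mvD.
  - move=> j jN; have := close i X j (ltnW iN) liftX jN.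
    have tt : `|tgt i j.+1 - tgt i j| <= D * h.
      rewrite /tgt opprD addrACA subrr add0r -scalerBr opprB addrA subrK normrZ.
      have ih := jh i (ltnW iN).
      have ih0 : 0 <= i%:R * h by rewrite mulr_ge0// ltW.
      rewrite ger0_norm ?subr_ge0//; apply: le_trans (fgamS j).
      by rewrite ler_piMl//; lra.
    move=> h1; have {}h1 : `|X j.+1 - X j| <= D / c1 * h.
      apply: le_trans h1 _; rewrite mulrAC [leRHS]mulrC ler_pM2l ?invr_gt0//.
    have := mvD j (ltnW jN); have := mvD j.+1 jN.
    have -> : Y j.+1 - Y j = (Y j.+1 - X j.+1) + (X j.+1 - X j) - (Y j - X j).
      by rewrite addrA subrK opprB addrA subrK.
    move=> h2 h3; apply: le_trans stepr; apply: le_trans (ler_normB _ _) _.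
    have := ler_normD (Y j.+1 - X j.+1) (X j.+1 - X j).
    by rewrite mulrDl; lra.
have [X liftX] := lift N (leqnn N); have [X0 XN _ _] := liftX.
have tgtN j : tgt N j = y0 by rewrite /tgt Nh subrr scale0r addr0.
suff : forall j, (j <= N)%N -> X j = a by move=> /(_ N (leqnn N)) <-.
elim=> [//|j IH jN]; rewrite -(IH (ltnW jN)).
apply/eqP; rewrite -subr_eq0 -normr_le0; apply: le_trans (close N X j (leqnn N) liftX jN) _.
by rewrite !tgtN subrr normr0 mulr0.
Qed.

Theorem corollary4p6 (R : realType) (n : nat) (f : 'rV[R]_n -> 'rV[R]_n)
    (f_lip : lipschitz f)
    (f_rank : forall x : 'rV[R]_n, maximal_rank (clarke_diff f x))
    (f_spec : exists2 eps : R, 0 < eps &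
       forall x : 'rV[R]_n,
         Spec (clarke_diff f x) `&` [set z : R[i] | `|z| <= eps%:C] = set0) :
  homeomorphism f.
Proof.
have [eps eps0 spec] := f_spec.
have [L L0 lipf] : exists2 L : R, 0 <= L & forall x y, `|f x - f y| <= L * `|x - y|.
  have /pinfty_ex_gt0[M M0 H] := f_lip.
  by exists M; [exact: ltW|move=> x y; exact: (H (x, y))].
pose kap := eps ^+ n / (n%:R * (n.-1`!%:R * L ^+ n.-1) + 1).
have kap0 : 0 < kap.
  by rewrite divr_gt0 ?exprn_gt0// ltr_wpDl// !mulr_ge0// exprn_ge0.
have lower x A : clarke_diff f x A -> forall v : 'rV[R]_n,
    kap * `|v| <= `|v *m A| /\ kap * `|v| <= `|v *m A^T|.
  move=> xA v; have AL i j := clarke_entry_le lipf i j xA.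
  have detA : eps ^+ n <= `|\det A|.
    apply: det_spec_ge => // z zA zeps.
    have : (Spec (clarke_diff f x) `&` [set z : R[i] | `|z| <= eps%:C]) z.
      by split => //; exists A.
    by rewrite spec.
  split; first exact: mulmx_lower.
  by apply: mulmx_lower => //; [move=> i j; rewrite mxE|rewrite det_tr].
have reg := metric_regularity L0 lipf kap0 lower.
have inj : injective f.
  have := @regular_injective R 'rV[R]_n f _ _ _ L0 lipf (inj_const_gt0 L0 kap0)
    (reg_const_ge0 L0 kap0) (uniform_injectivity L0 lipf kap0 lower).
  by apply.
split; first exact: norm_lip_continuous lipf.
have /choice[g fg] y : exists z, f z = y by have [z] := reg 0 y; exists z.
have gf : cancel f g by move=> x; apply: inj.
exists g; split => //.
apply: (norm_lip_continuous (reg_const_ge0 L0 kap0)) => x y.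
(* Solving [f z = x] near [g y] can only give [g x], so metric regularity is a Lipschitz bound for
   the inverse. *)
have [z fz] := reg (g y) x; rewrite fg (distrC y) => gz.
have -> : g x = z by rewrite -fz gf.
exact: gz.
Qed.
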